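(* Let $(R_n)_{n\ge 1}$ be an Oppenheim expansion sequence with related distribution function $F$, built from $(B_n)$, $(\varphi_n)$, $(Y_n)$ (see context). Assume that there exists a good sequence $\Lambda=(\lambda_j)_{j\ge 0}$ such that, for every $x\in\Lambda$ and for every $n$, $x\varphi_n(B_n)+(x-1)Y_n\varphi_n(B_n)$ is an integer. Put $X_n=\lambda_{j_{R_n}}$. (a) Assume that there exist two positive constants $C_1<C_2$ with $$C_1\le \frac{F(x)}{x}\le C_2\qquad\text{for all }x\in(0,1].$$ Then there exists a constant $C>0$ such that, letting $r_n=\lceil \beta n^{1-\gamma}\rceil$, where $0<\gamma<\frac12$ and $\beta>C$, and $d_n=\sum_{k=1}^n E\big[X_k1_{\{X_k\le n^\gamma\}}\big]$, we have $$\lim_{n\to\infty}\frac{S_n^{r_n}}{d_n}=1\quad\text{almost surely.}$$ (b) Assume that $$\lim_{x\to0}\frac{F(x)}{x}=\alpha>0.$$ Then, for the same sequence $(r_n)_{n\ge1}$ as in part (a), we have $$\lim_{n\to\infty}\frac{S_n^{r_n}}{n\log n}=\alpha\gamma\quad\text{almost surely.}$$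
   Context: **Oppenheim expansion sequences.** Let $(\Omega,\mathcal A,P)$ be $[0,1]$ with its Borel $\sigma$-algebra and Lebesgue measure, and $\mathbb N^*=\{1,2,\dots\}$. Let $(B_n)_{n\ge1}$ be random variables on $\Omega$ with values in $\mathbb N^*$, let $F$ be a distribution function with $F(0)=0$, $F(1)=1$, let $\varphi_n:\mathbb N^*\to(0,\infty)$ be functions, and let $y_n=y_n(h_1,\dots,h_n)\ge0$ be nonnegative numbers possibly depending on the integers $h_1,\dots,h_n$. Set $$\delta_n(h,k,y)=\frac{\varphi_n(h)(1+y)}{k+\varphi_n(h)y}.$$ Assume that $B_{n+1}\ge\varphi_n(B_n)$ almost surely for every $n$, and that for every $n\ge1$ and all integers $h_1\ge1$, $h_j\ge\varphi_{j-1}(h_{j-1})$ ($j=2,\dots,n+1$) such that the conditioning event has positive probability, $$P(B_{n+1}=h_{n+1}\mid B_n=h_n,\dots,B_1=h_1)=F(\beta_n)-F(\alpha_n),$$ where $\alpha_n=\delta_n(h_n,h_{n+1}+1,y_n)$, $\beta_n=\delta_n(h_n,h_{n+1},y_n)$ and $y_n=y_n(h_1,\dots,h_n)$. Let $Y_n=y_n(B_1,\dots,B_n)$ and $$R_n=\frac{B_{n+1}+\varphi_n(B_n)Y_n}{\varphi_n(B_n)(1+Y_n)}=\frac1{\delta_n(B_n,B_{n+1},Y_n)}$$ (so $R_n\ge1$ almost surely). Then $(R_n)_{n\ge1}$ is called an Oppenheim expansion sequence with related distribution function $F$. **Good sequences.** A strictly increasing sequence $\Lambda=(\lambda_j)_{j\ge0}$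 of reals tending to $+\infty$ is called good if $\lambda_0=0$, $\lambda_j\ge1$ for every $j\ge1$, and $\sup_n(\lambda_{n+1}-\lambda_n)=\ell<+\infty$. (The term $\lambda_0=0$ belongs to $\Lambda$.) For $u\ge1$, $j_u$ is the unique integer with $\lambda_{j_u-1}\le u<\lambda_{j_u}$. **Trimmed sums.** For each $n$ let $\sigma$ be a (random) permutation of $\{1,\dots,n\}$ with $R_{\sigma(1)}\ge R_{\sigma(2)}\ge\dots\ge R_{\sigma(n)}$; then $S_n^{r_n}=\sum_{k=r_n+1}^n R_{\sigma(k)}$ (the sum of $R_1,\dots,R_n$ with the $r_n$ largest terms removed; an empty sum, for the finitely many $n$ with $r_n\ge n$, is $0$). *)

(* Defs.v *)
From HB Require Import structures.
From mathcomp Require Import all_boot all_order all_algebra.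
From mathcomp Require Import all_classical all_reals all_analysis.

Set Implicit Arguments.
Unset Strict Implicit.
Unset Printing Implicit Defensive.

Import Order.TTheory GRing.Theory Num.Theory.
Import numFieldNormedType.Exports.

Local Open Scope classical_set_scope.
Local Open Scope ring_scope.

(* [0, 1] as a subtype of R, with the trace of the Borel sigma-algebra and the
   measure A |-> lebesgue_measure (val @` A). *)
Section unit_interval.
Variable R : realType.

Definition unit_pts : Type := {x : R | (0 <= x <= 1)%R}.

HB.instance Definition _ := Choice.on unit_pts.

Lemma unit_pts0 : (0 <= (0 : R) <= 1)%R.
Proof. by rewrite lexx ler01. Qed.

HB.instance Definition _ :=
  isPointed.Build unit_pts (exist _ (0 : R) unit_pts0).

Definition unit_val (x : unit_pts) : measurableTypeR R := sval x.

Definition unit_interval := g_sigma_algebra_preimageType unit_val.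

Definition unit_lebesgue (A : set unit_interval) : \bar R :=
  lebesgue_measure (unit_val @` A : set (measurableTypeR R)).

Lemma unit_val_image (B : set (measurableTypeR R)) :
  unit_val @` (unit_val @^-1` B) = B `&` `[0, 1].
Proof.
apply/seteqP; split=> [_ [x Bx <-]|x [Bx]] /=.
  by split => //; rewrite /unit_val in_itv /=; exact: (svalP x).
by rewrite in_itv /= => x01; exists (exist _ x x01).
Qed.

Lemma measurable_unit_image (A : set unit_interval) :
  measurable A -> measurable (unit_val @` A : set (measurableTypeR R)).
Proof.
case=> B mB <-; rewrite setTI unit_val_image.
by apply: measurableI => //; exact: measurable_itv.
Qed.

Let unit_lebesgue0 : unit_lebesgue set0 = 0%E.
Proof. by rewrite /unit_lebesgue image_set0 measure0. Qed.

Let unit_lebesgue_ge0 A : (0 <= unit_lebesgue A)%E.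
Proof. exact: measure_ge0. Qed.

Let unit_lebesgue_sigma_additive : semi_sigma_additive unit_lebesgue.
Proof.
move=> G mG tG mUG; rewrite /unit_lebesgue image_bigcup.
apply: measure_semi_sigma_additive.
- by move=> i; exact: measurable_unit_image.
- apply/trivIsetP => i j _ _ ij; apply/seteqP; split=> //.
  move=> x [[a Ga ax] [b Gb bx]].
  move/trivIsetP : tG => /(_ i j Logic.I Logic.I ij) /seteqP[+ _].
  move=> /(_ a); apply.
  split=> //; suff -> : a = b by [].
  by apply: val_inj; rewrite /= -[LHS]/(unit_val a) ax -bx.
- by rewrite -image_bigcup; exact: measurable_unit_image.
Qed.

HB.instance Definition _ := isMeasure.Build _ _ _ unit_lebesgue
  unit_lebesgue0 unit_lebesgue_ge0 unit_lebesgue_sigma_additive.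

Let unit_lebesgue_setT : unit_lebesgue setT = 1%:E.
Proof.
rewrite /unit_lebesgue -(preimage_setT unit_val) unit_val_image setTI.
by rewrite lebesgue_measure_itv /= lte_fin ltr01 oppr0 adde0.
Qed.

HB.instance Definition _ :=
  @Measure_isProbability.Build _ _ R unit_lebesgue unit_lebesgue_setT.

End unit_interval.
Arguments unit_lebesgue : clear implicits.

Definition cond_prob d (T : measurableType d) (R : realType)
    (P : probability T R) (A C : set T) : R :=
  fine (P (A `&` C)) / fine (P C).

(* Sequences are indexed by n >= 1: the value of B, phi, y at index 0 is never
   constrained nor used. *)
Section oppenheim.
Context d (T : measurableType d) (R : realType) (P : probability T R).
Variables (B : nat -> {RV P >-> nat}) (phi : nat -> nat -> R).
Variable y : forall n : nat, n.-tuple nat -> R.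

Definition opp_delta (n h k : nat) (z : R) : R :=
  phi n h * (1 + z) / (k%:R + phi n h * z).

Definition opp_Y (n : nat) (w : T) : R := y [tuple B i.+1 w | i < n].

Definition opp_R (n : nat) (w : T) : R :=
  ((B n.+1 w)%:R + phi n (B n w) * opp_Y n w) /
  (phi n (B n w) * (1 + opp_Y n w)).

Definition opp_past (n : nat) (h : nat -> nat) : set T :=
  [set w | forall j, (1 <= j <= n)%N -> B j w = h j].

Record oppenheim_expansion (F : cumulativeBounded (0 : R) (1 : R)) : Prop := {
  opp_F0 : F 0 = 0 ;
  opp_F1 : F 1 = 1 ;
  opp_B_gt0 : forall n w, (1 <= n)%N -> (1 <= B n w)%N ;
  opp_phi_gt0 : forall n h, (1 <= n)%N -> (1 <= h)%N -> 0 < phi n h ;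
  opp_y_ge0 : forall n (h : n.-tuple nat), (1 <= n)%N ->
    (forall i, (1 <= tnth h i)%N) -> 0 <= y h ;
  opp_B_ge : forall n, (1 <= n)%N ->
    {ae P, forall w, phi n (B n w) <= (B n.+1 w)%:R} ;
  opp_cond : forall (n : nat) (h : nat -> nat), (1 <= n)%N ->
    (1 <= h 1)%N ->
    (forall j, (2 <= j <= n.+1)%N -> phi j.-1 (h j.-1) <= (h j)%:R) ->
    (0 < P (opp_past n h))%E ->
    let yn := y [tuple h i.+1 | i < n] in
    cond_prob P [set w | B n.+1 w = h n.+1] (opp_past n h) =
    F (opp_delta n (h n) (h n.+1) yn) - F (opp_delta n (h n) (h n.+1).+1 yn)
}.

End oppenheim.

Record good_sequence (R : realType) (lam : nat -> R) : Prop := {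
  good_incr : {homo lam : m n / (m < n)%N >-> m < n} ;
  good_cvg : lam n @[n --> \oo] --> +oo ;
  good_0 : lam 0%N = 0 ;
  good_ge1 : forall j, (1 <= j)%N -> 1 <= lam j ;
  good_gap : has_ubound (range (fun n => lam n.+1 - lam n))
}.

(* j_u; the set below is a singleton when lam is good and u >= 0. *)
Definition good_index (R : realType) (lam : nat -> R) (u : R) : nat :=
  xget 0%N [set j | (1 <= j)%N /\ lam j.-1 <= u < lam j].

(* Sum of Z 1 w, ..., Z n w without the r largest terms (with multiplicity). *)
Definition trimmed_sum (T : Type) (R : realType) (Z : nat -> T -> R)
    (r n : nat) (w : T) : R :=
  \sum_(z <- drop r (sort >=%O [seq Z k w | k <- iota 1 n])) z.

Definition trim_rank (R : realType) (beta gamma : R) (n : nat) : nat :=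
  `|Num.ceil (beta * n%:R `^ (1 - gamma))|%N.

Definition truncated_mean d (T : measurableType d) (R : realType)
    (P : probability T R) (X : nat -> T -> R) (gamma : R) (n : nat) : R :=
  \sum_(1 <= k < n.+1)
    fine ('E_P[(fun w => X k w * \1_[set v | X k v <= n%:R `^ gamma] w)%R])%E.

(* Main.v *)
Require Import Defs.
From mathcomp Require Import all_boot all_order all_algebra.
From mathcomp Require Import all_classical all_reals all_analysis.
From mathcomp Require Import measurable_realfun ring lra.

Set Implicit Arguments.
Unset Strict Implicit.
Unset Printing Implicit Defensive.

Import Order.TTheory GRing.Theory Num.Theory.
Import numFieldNormedType.Exports.

Local Open Scope classical_set_scope.
Local Open Scope ring_scope.

(** Put X_n = lam (j_(R_n)). Since R_n < X_n <= R_n + l, where l bounds the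
    gaps of lam, replacing R by X changes a sum of n terms by at most n * l,
    which is negligible against d_n. What is gained is independence. For
    j >= 1, the event X_n > lam j is R_n >= lam j, that is B_(n+1) >= m with
    m = lam j * phi + (lam j - 1) * Y * phi. Because m is an integer, summing
    the conditional law of B_(n+1) over k >= m telescopes exactly to F (1 / lam
    j), whatever the past is. So the X_n are independent with
    P(X_n > lam j) = F (1 / lam j) ([lam_index_tail], [iid_lam_index]).

    For independent indices J_k with tail t such that lam j * t j is bounded,
    truncate at M = n^gamma. Let mu be the truncated mean, so d_n = n * mu.
    Exponential moments factor ([integral_prod_J]), and Chernoff's bound
    ([chernoff_J]) is applied twice.
    - With exponent s = 1 / (2 M), the second truncated moment being O(M)
      ([moment2_le]), a relative deviation of the truncated sum from d_n has
      probability at most exp (- n^(1-gamma)) once mu is large.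
    - With exponent 1, more than beta * n^(1-gamma) of the X_k exceed M with
      probability at most exp (- n^(1-gamma)) once beta is large enough.
    As gamma < 1/2, exp (- n^(1-gamma)) <= exp (- sqrt n) is summable, and the
    first Borel-Cantelli lemma ([ae_eventually_not]) makes both deviations
    impossible for large n, almost surely.

    Then the r_n largest terms include all those above M, and trimming removes
    from the truncated sum at most r_n terms, each at most M. As r_n * M = O(n),
    the trimmed sum is d_n + o(d_n) as soon as mu tends to infinity
    ([trimmed_trunc_sum], [ae_trimmed_sum]).

    Finally, summation by parts gives mu = sum (lam (j+1) - lam j) * t j + O(1),
    the sum over lam (j+1) <= M, and sum (lam (j+1) - lam j) / lam j is
    log M + O(1) ([lam_harmonic_bounds]). A lower bound t j >= C1 / lam j makes
    mu infinite in the limit ([moment1_pinfty]); t j ~ alpha / lam j gives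
    mu ~ alpha * log M = alpha * gamma * log n ([moment1_ln],
    [cvg_ln_level]). *)

(** * Good sequences *)

Section good_sequences.
Variables (R : realType) (lam : nat -> R).
Hypothesis good : good_sequence lam.

Lemma good_le i j : (i <= j)%N -> lam i <= lam j.
Proof.
rewrite leq_eqVlt => /predU1P[-> //|ij].
exact/ltW/(good_incr good).
Qed.

Lemma good_ge0 j : 0 <= lam j.
Proof. by rewrite -(good_0 good) good_le. Qed.

Lemma good_indexP u : 0 <= u ->
  (1 <= good_index lam u)%N /\
  lam (good_index lam u).-1 <= u < lam (good_index lam u).
Proof.
move=> u0; apply: (@xgetPex _ 0%N [set j | (1 <= j)%N /\ lam j.-1 <= u < lam j]).
have [N ltuN] : exists N, u < lam N.
  have /cvgryPgt/(_ u)[N _ HN] := good_cvg good.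
  by exists N; apply: HN => /=.
have ex : exists N, u < lam N by exists N.
case: (ex_minnP ex) => -[|m] ltum minm.
  by move: ltum; rewrite (good_0 good) ltNge u0.
exists m.+1; split=> //=; rewrite ltum andbT leNgt.
by apply/negP => /minm; rewrite ltnn.
Qed.

Lemma good_index_gt0 u : 0 <= u -> (1 <= good_index lam u)%N.
Proof. by move/good_indexP => []. Qed.

Lemma ltn_good_index j u : 0 <= u -> (j < good_index lam u)%N = (lam j <= u).
Proof.
move=> /good_indexP[g1 /andP[leu ltu]]; apply/idP/idP => [jg|].
  by apply: le_trans leu; apply: good_le; rewrite -ltnS prednK.
apply: contraTT; rewrite -leqNgt -ltNge => /good_le; exact: lt_le_trans.
Qed.

End good_sequences.

Section level.
Variables (R : realType) (lam : nat -> R).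
Hypothesis good : good_sequence lam.

(** The last j such that lam j <= x; the truncation X_k <= x reads
    J_k <= level x on indices. *)
Definition level (x : R) : nat := (good_index lam x).-1.

Lemma leq_level j x : 0 <= x -> (j <= level x)%N = (lam j <= x).
Proof.
move=> x0; rewrite -(ltn_good_index good)// /level.
by rewrite -[in RHS](prednK (good_index_gt0 good x0)) ltnS.
Qed.

Lemma lam_level_le x : 0 <= x -> lam (level x) <= x.
Proof. by move=> x0; rewrite -leq_level. Qed.

Lemma lt_lam_levelS x : 0 <= x -> x < lam (level x).+1.
Proof. by move=> x0; rewrite ltNge -leq_level// ltnn. Qed.

Lemma cvg_powR_infty (g : R) : 0 < g -> n%:R `^ g @[n --> \oo] --> +oo.
Proof.
move=> g0; apply/cvgryPge => A.
apply: filterS (nbhs_infty_ger (`|A| `^ g^-1)) => n An.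
apply: le_trans (ler_norm A) _.
have -> : `|A| = (`|A| `^ g^-1) `^ g by rewrite -powRrM mulVf ?gt_eqF// powRr1.
by rewrite ge0_ler_powR ?nnegrE ?powR_ge0// ltW.
Qed.

Lemma cvg_level (g : R) : 0 < g -> level (n%:R `^ g) @[n --> \oo] --> \oo.
Proof.
move=> g0; apply/cvgnyPge => N.
have /cvgryPge/(_ (lam N)) := cvg_powR_infty g0.
by apply: filterS => n; rewrite leq_level// powR_ge0.
Qed.

End level.

(** * Trimmed sums of finite families *)

Definition trunc (R : realType) (lam : nat -> R) m j : R :=
  if (j <= m)%N then lam j else 0.

Section trimmed.
Variables (R : realType) (s : seq R) (M : R) (r : nat).
Hypotheses (M0 : 0 <= M) (s0 : forall z, z \in s -> 0 <= z).

Let s' := sort >=%O s.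

Let perm_s' : perm_eq s' s. Proof. by rewrite /s' perm_sort. Qed.

(** When at most r entries exceed M, those all lie among the r removed ones. *)
Lemma trimmed_le : (count (> M)%R s <= r)%N ->
  \sum_(z <- drop r s') z <= \sum_(z <- s | z <= M) z.
Proof.
move=> cr; rewrite -(perm_big _ perm_s') /= -{2}(cat_take_drop r s') big_cat/=.
(* An entry above M at a rank i >= r would make the first r.+1 entries of the
   nonincreasing sequence exceed M. *)
have small z : z \in drop r s' -> z <= M.
  move=> /(nthP 0)[i]; rewrite size_drop nth_drop ltn_subRL => ri <-.
  rewrite leNgt; apply/negP => Mz.
  have sorted_s' : sorted >=%O s' by apply: sort_sorted; exact: ge_total.
  have : (r.+1 <= count (> M)%R s')%N.
    rewrite -(cat_take_drop r.+1 s') count_cat.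
    have rs : (r < size s')%N by apply: leq_ltn_trans ri; exact: leq_addr.
    suff /eqP -> : count (> M)%R (take r.+1 s') == r.+1 by rewrite leq_addr.
    rewrite -[X in _ == X](size_takel rs) -all_count; apply/(all_nthP 0) => j.
    rewrite size_takel// ltnS => jr; rewrite nth_take//=.
    apply: lt_le_trans Mz _.
    apply: (sorted_leq_nth ge_trans ge_refl 0 sorted_s'); rewrite ?inE//.
    - exact: leq_ltn_trans rs.
    - by rewrite (leq_trans jr)// leq_addr.
  by rewrite (permP perm_s') ltnNge cr.
rewrite [X in X <= _]big_seq_cond [X in _ <= _ + X]big_seq_cond.
have -> : \sum_(z <- drop r s' | (z \in drop r s') && true) z =
  \sum_(z <- drop r s' | (z \in drop r s') && (z <= M)) z.
  by apply: eq_bigl => z; case: (boolP (_ \in _)) => // /small ->.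
rewrite lerDr big_seq_cond sumr_ge0// => z /andP[zs _].
by apply: s0; rewrite -(perm_mem perm_s'); exact: mem_take zs.
Qed.

(** Each of the r removed entries contributes at most M to the truncated sum. *)
Lemma trimmed_ge :
  \sum_(z <- s | z <= M) z - r%:R * M <= \sum_(z <- drop r s') z.
Proof.
rewrite -(perm_big _ perm_s') /= -{1}(cat_take_drop r s') big_cat/=.
have H1 : \sum_(z <- take r s' | z <= M) z <= r%:R * M.
  apply: (@le_trans _ _ (\sum_(z <- take r s') M)).
    rewrite [X in _ <= X](bigID (fun z => z <= M))/= ler_wpDr//.
      exact: sumr_ge0.
    exact: ler_sum.
  rewrite big_const_seq count_predT iter_addr_0 -[X in X <= _]mulr_natl ler_wpM2r//.
  by rewrite ler_nat size_take; case: ltnP.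
have H2 : \sum_(z <- drop r s' | z <= M) z <= \sum_(z <- drop r s') z.
  rewrite [X in _ <= X](bigID (fun z => z <= M))/= lerDl big_seq_cond.
  apply: sumr_ge0 => z /andP[zs _].
  by apply: s0; rewrite -(perm_mem perm_s'); exact: mem_drop zs.
lra.
Qed.

End trimmed.

Section pathwise.
Variables (R : realType) (lam z : nat -> R) (J : nat -> nat) (l : R).
Hypothesis l0 : 0 <= l.
Hypothesis good : good_sequence lam.
Hypothesis z0 : forall k, (1 <= k)%N -> 0 <= z k.
Hypothesis zJ : forall k, (1 <= k)%N -> z k <= lam (J k) <= z k + l.

(** The term n * l pays for replacing z k by lam (J k) below M; the term r * M
    pays for the entries below M that are trimmed, and for those z k <= M
    whose lam (J k) exceeds M. *)
Lemma trimmed_trunc_sum (M : R) (n r : nat) : 0 <= M ->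
  \sum_(1 <= k < n.+1) ((level lam M < J k)%N)%:R <= r%:R :> R ->
  `|\sum_(x <- drop r (sort >=%O [seq z k | k <- iota 1 n])) x -
    \sum_(1 <= k < n.+1) trunc lam (level lam M) (J k)| <=
  r%:R * M + n%:R * l.
Proof.
move=> M0 exc; set s := [seq z k | k <- iota 1 n].
have s0 x : x \in s -> 0 <= x.
  by move=> /mapP[k]; rewrite mem_iota => /andP[k1 _] ->; exact: z0.
have iotaE : iota 1 n = index_iota 1 n.+1 by rewrite /index_iota subSS subn0.
have MJ k : (J k <= level lam M)%N = (lam (J k) <= M) by rewrite leq_level.
have cnt : (count (> M)%R s <= r)%N.
  rewrite -(ler_nat R); apply: le_trans exc.
  rewrite count_map -sum1_count big_mkcond natr_sum -iotaE.
  rewrite [X in X <= _]big_seq [X in _ <= X]big_seq; apply: ler_sum => k.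
  rewrite mem_iota => /andP[k1 _] /=; have /andP[zle _] := zJ k1.
  by rewrite ltnNge MJ ler_nat -ltNge; case: ltP => // /lt_le_trans ->.
have up := trimmed_le s0 cnt; have lo := trimmed_ge r M0 s0.
have sE : \sum_(x <- s | x <= M) x =
    \sum_(1 <= k < n.+1) (if z k <= M then z k else 0).
  by rewrite big_map -iotaE big_mkcond.
have h1 : \sum_(1 <= k < n.+1) (if z k <= M then z k else 0) <=
   \sum_(1 <= k < n.+1) trunc lam (level lam M) (J k) + r%:R * M.
  apply: le_trans (lerD (lexx _) (ler_wpM2r M0 exc)).
  rewrite mulr_suml -big_split/=; apply: ler_sum_nat => k /andP[k1 _].
  have /andP[zle _] := zJ k1; have := z0 k1.
  rewrite /trunc ltnNge MJ; case: (lerP (lam (J k)) M) => h; case: ifP => //=; lra.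
have h2 : \sum_(1 <= k < n.+1) trunc lam (level lam M) (J k) <=
    \sum_(1 <= k < n.+1) (if z k <= M then z k else 0) + n%:R * l.
  have -> : n%:R * l = \sum_(1 <= k < n.+1) l.
    by rewrite sumr_const_nat subSS subn0 mulr_natl.
  rewrite -big_split/=; apply: ler_sum_nat => k /andP[k1 _].
  have /andP[zle zge] := zJ k1; have := z0 k1.
  rewrite /trunc MJ; case: (lerP (lam (J k)) M) => h; case: ifP => //=;
    move/negP/negP; rewrite -?ltNge; lra.
rewrite sE in up lo; have nl : 0 <= n%:R * l by rewrite mulr_ge0.
by rewrite ler_norml; lra.
Qed.

End pathwise.

Lemma trim_rank_bounds (R : realType) (beta gamma : R) n : 0 <= beta ->
  beta * n%:R `^ (1 - gamma) <= (trim_rank beta gamma n)%:R <=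
  beta * n%:R `^ (1 - gamma) + 1.
Proof.
move=> b0; set x := _ * _; have x0 : 0 <= x by rewrite mulr_ge0// powR_ge0.
rewrite /trim_rank -/x natr_absz ger0_norm; last by rewrite ceil_ge0; lra.
by have /andP[] := ceil_itv x; rewrite intrB; lra.
Qed.

(** * Truncated moments of the law with a given tail *)

Definition law (R : realType) (t : nat -> R) (j : nat) : R :=
  if j is i.+1 then t i - t i.+1 else 0.

(* Here t is the tail of the index: t j stands for the probability that it
   exceeds j. *)
Section moments.
Variables (R : realType) (lam t : nat -> R) (l K : R).
Hypothesis good : good_sequence lam.
Hypothesis gap : forall n, lam n.+1 - lam n <= l.
Hypothesis t0 : t 0%N = 1.
Hypothesis t_ge0 : forall j, 0 <= t j.
Hypothesis t_le : forall j, lam j * t j <= K.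

Definition moment1 (m : nat) : R := \sum_(1 <= j < m.+1) lam j * law t j.
Definition moment2 (m : nat) : R := \sum_(1 <= j < m.+1) lam j ^+ 2 * law t j.

(** Summation by parts. *)
Lemma sum_law (a : nat -> R) m : \sum_(1 <= j < m.+1) a j * law t j =
  a 0%N * t 0%N - a m * t m + \sum_(0 <= j < m) (a j.+1 - a j) * t j.
Proof.
elim: m => [|m IH]; first by rewrite !big_geq// addr0 subrr.
by rewrite big_nat_recr//= IH (big_nat_recr m)//=; ring.
Qed.

(** The first gap is lam 1 - lam 0 = lam 1. *)
Lemma gap_ge1 : 1 <= l.
Proof.
apply: le_trans (gap 0%N); rewrite (good_0 good) subr0; exact: good_ge1.
Qed.

Lemma lam_gt0 j : (1 <= j)%N -> 0 < lam j.
Proof. by move=> j1; apply: lt_le_trans (good_ge1 good j1). Qed.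

Lemma lamS_le j : (1 <= j)%N -> lam j.+1 <= (1 + l) * lam j.
Proof.
by move=> j1; have := good_ge1 good j1; have := gap j; have := gap_ge1; nra.
Qed.

Lemma tail_const_ge0 : 0 <= K.
Proof. by apply: le_trans (t_le 0%N); rewrite (good_0 good) mul0r. Qed.

(** The tail is t j on the whole interval from lam j to lam (j+1), so it has
    to be compared with the right end point. At j = 0 the bound K says nothing
    on t 0 = 1, hence the summand l. *)
Lemma lamS_tail j : lam j.+1 * t j <= (1 + l) * K + l.
Proof.
case: j => [|j].
  rewrite t0 mulr1; have := gap 0%N; rewrite (good_0 good) subr0.
  have : 0 <= (1 + l) * K by have := tail_const_ge0; have := gap_ge1; nra.
  lra.
have := @lamS_le j.+1 isT; have := t_le j.+1; have := t_ge0 j.+1; have := gap_ge1.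
nra.
Qed.

Definition moment2_const : R := ((1 + l) * K + l) + K.

(** In the sum by parts, the increments of lam ^ 2 times t are bounded by a
    constant times the increments of lam, which telescope. *)
Lemma moment2_le m : moment2 m <= moment2_const * lam m.
Proof.
rewrite /moment2 sum_law (good_0 good) expr0n/= mul0r sub0r.
have -> : lam m = \sum_(0 <= j < m) (lam j.+1 - lam j).
  by rewrite telescope_sumr// (good_0 good) subr0.
rewrite mulr_sumr -[X in _ <= X]add0r lerD//.
  by rewrite oppr_le0 mulr_ge0// sqr_ge0.
apply: ler_sum_nat => j _; rewrite subr_sqr -mulrA mulrC.
apply: ler_wpM2r; first by rewrite subr_ge0 good_le.
by rewrite mulrDl lerD// ?lamS_tail ?t_le.
Qed.

Lemma moment1E m : moment1 m =
  \sum_(0 <= j < m) (lam j.+1 - lam j) * t j - lam m * t m.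
Proof. by rewrite /moment1 sum_law (good_0 good); ring. Qed.

Definition lam_harmonic m := \sum_(1 <= j < m) (lam j.+1 - lam j) / lam j.

(** A Riemann sum of 1 / x. Its terms lie between the increments of ln and
    those increments plus l * (1 / lam j - 1 / lam (j+1)): the excess is a
    telescoping sum, so the error stays bounded. *)
Lemma lam_harmonic_bounds m : (1 <= m)%N ->
  ln (lam m) - ln (lam 1) <= lam_harmonic m <= ln (lam m) - ln (lam 1) + l.
Proof.
move=> m1.
suff /andP[-> /=] : ln (lam m) - ln (lam 1) <= lam_harmonic m <=
    ln (lam m) - ln (lam 1) + l * ((lam 1)^-1 - (lam m)^-1).
  move/le_trans; apply; rewrite lerD2l.
  have : (lam 1)^-1 <= 1 by rewrite invf_le1 ?lam_gt0// good_ge1.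
  have : 0 < (lam m)^-1 by rewrite invr_gt0 lam_gt0.
  by have := gap_ge1; nra.
case: m m1 => // m _; elim: m => [|m /andP[IH1 IH2]].
  by rewrite /lam_harmonic big_geq// !subrr mulr0 addr0 lexx.
have p1 := @lam_gt0 m.+1 isT; have p2 := @lam_gt0 m.+2 isT.
rewrite /lam_harmonic big_nat_recr//= -/(lam_harmonic m.+1).
have e1 : (lam m.+2 - lam m.+1) / lam m.+1 = lam m.+2 / lam m.+1 - 1.
  by rewrite mulrBl divff// gt_eqF.
have up : ln (lam m.+2) - ln (lam m.+1) <= (lam m.+2 - lam m.+1) / lam m.+1.
  rewrite -ln_div ?posrE// e1 -{1}(subrKC 1 (lam m.+2 / lam m.+1)).
  by apply: le_ln1Dx; rewrite ltrBrDl subrr divr_gt0.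
have lo : 1 - lam m.+1 / lam m.+2 <= ln (lam m.+2) - ln (lam m.+1).
  rewrite -(lerN2 (_ - _)) !opprB -ln_div ?posrE//.
  rewrite -{1}(subrKC 1 (lam m.+1 / lam m.+2)).
  by apply: le_ln1Dx; rewrite ltrBrDl subrr divr_gt0.
have gp : (lam m.+2 - lam m.+1) / lam m.+1 <=
    1 - lam m.+1 / lam m.+2 + l * ((lam m.+1)^-1 - (lam m.+2)^-1).
  rewrite -(divff (lt0r_neq0 p2)) -mulrBl.
  have : (lam m.+2)^-1 <= (lam m.+1)^-1 by rewrite lef_pV2 ?posrE// good_le.
  by have := gap m.+1; nra.
by apply/andP; split; lra.
Qed.

Lemma cvg_ln_lam : ln (lam m) @[m --> \oo] --> +oo.
Proof.
apply/cvgryPge => A; have /cvgryPge/(_ (expR A)) := good_cvg good.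
apply: filterS => m Am; rewrite -(expRK A) ler_ln ?posrE ?expR_gt0//.
exact: lt_le_trans (expR_gt0 A) Am.
Qed.

Let moment1_split m : (1 <= m)%N ->
  moment1 m = lam 1 + \sum_(1 <= j < m) (lam j.+1 - lam j) * t j - lam m * t m.
Proof.
by move=> m1; rewrite moment1E (big_ltn m1) t0 (good_0 good) subr0 mulr1.
Qed.

Let Dlam_ge0 j : 0 <= lam j.+1 - lam j.
Proof. by rewrite subr_ge0 good_le. Qed.

Lemma moment1_pinfty (c : R) : 0 < c ->
  (forall j, (1 <= j)%N -> c <= lam j * t j) ->
  moment1 m @[m --> \oo] --> +oo.
Proof.
move=> c0 ct; apply/cvgryPge => A.
have /cvgryPge/(_ ((A + K) / c + ln (lam 1))) := cvg_ln_lam.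
apply: filterS2 (nbhs_infty_ge 1%N) => m /= m1 Am; rewrite moment1_split//.
have /andP[h _] := lam_harmonic_bounds m1.
have sumc : c * lam_harmonic m <= \sum_(1 <= j < m) (lam j.+1 - lam j) * t j.
  rewrite mulr_sumr; apply: ler_sum_nat => j /andP[j1 _].
  rewrite mulrCA ler_wpM2l ?Dlam_ge0// ler_pdivrMr ?lam_gt0// mulrC.
  exact: ct.
have : A + K <= c * lam_harmonic m.
  by rewrite mulrC -ler_pdivrMr//; apply: le_trans h; rewrite lerBrDr.
have := t_le m; have := lam_gt0 (leqnn 1%N); lra.
Qed.

(** The moment is, up to bounded terms, the average of lam j * t j with weights
    (lam (j+1) - lam j) / lam j, whose total is ln (lam m) + O(1): a weighted
    Cesaro argument. *)
Lemma moment1_ln (c : R) : 0 <= c -> lam j * t j @[j --> \oo] --> c ->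
  moment1 m / ln (lam m) @[m --> \oo] --> c.
Proof.
move=> c0 tc; apply/cvgrPdist_le => e e0.
have e2 : 0 < e / 2 by rewrite divr_gt0.
have /cvgrPdist_le/(_ _ e2)[N _ HN] := tc.
(* D collects the terms that do not grow with m. *)
pose N1 := N.+1.
pose D := lam 1 + K + c * (`|ln (lam 1)| + l) + (e / 2) * (`|ln (lam 1)| + l) +
  (K + c) * lam_harmonic N1.
have /cvgryPge/(_ (1 + 2 / e * D)) := cvg_ln_lam.
apply: filterS2 (nbhs_infty_ge N1) => m /= Nm Lm.
have m1 : (1 <= m)%N by apply: leq_trans Nm.
have /andP[h1 h2] := lam_harmonic_bounds m1.
have D0 : 0 <= D.
  have l0 := ltW (lt_le_trans ltr01 gap_ge1); have K0 := tail_const_ge0.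
  rewrite /D !addr_ge0// ?mulr_ge0// ?addr_ge0// ?(ltW (lam_gt0 _))//.
  - exact: ltW.
  - by rewrite /lam_harmonic sumr_ge0// => j _; rewrite divr_ge0 ?good_ge0 ?Dlam_ge0.
have L0 : 0 < ln (lam m).
  by apply: lt_le_trans Lm; rewrite ltr_wpDr// mulr_ge0// divr_ge0// ltW.
have LD : D <= e / 2 * ln (lam m).
  rewrite mulrC -ler_pdivrMr// invf_div mulrC.
  by apply: le_trans Lm; rewrite lerDr.
have key : `|\sum_(1 <= j < m) (lam j.+1 - lam j) * t j - c * lam_harmonic m| <=
    (K + c) * lam_harmonic N1 + e / 2 * lam_harmonic m.
  rewrite /lam_harmonic mulr_sumr -sumrB.
  apply: le_trans (ler_norm_sum _ _ _) _.
  rewrite (big_cat_nat (m := 1) (n := N1) _ Nm)//= lerD//.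
    rewrite mulr_sumr; apply: ler_sum_nat => j /andP[j1 _].
    have lj := lam_gt0 j1.
    rewrite (_ : _ - _ = (lam j.+1 - lam j) / lam j * (lam j * t j - c)); last first.
      by field; rewrite gt_eqF.
    have dj : 0 <= (lam j.+1 - lam j) / lam j by rewrite divr_ge0 ?Dlam_ge0 ?ltW.
    rewrite normrM (ger0_norm dj) mulrC ler_wpM2r//.
    have := t_le j; have := mulr_ge0 (good_ge0 good j) (t_ge0 j).
    by rewrite ler_norml; lra.
  apply: (@le_trans _ _ (e / 2 * \sum_(N1 <= j < m) (lam j.+1 - lam j) / lam j)).
    rewrite mulr_sumr; apply: ler_sum_nat => j /andP[jN _].
    have j1 : (1 <= j)%N by apply: leq_trans jN.
    have lj := lam_gt0 j1.
    rewrite (_ : _ - _ = (lam j.+1 - lam j) / lam j * (lam j * t j - c)); last first.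
      by field; rewrite gt_eqF.
    have dj : 0 <= (lam j.+1 - lam j) / lam j by rewrite divr_ge0 ?Dlam_ge0 ?ltW.
    rewrite normrM (ger0_norm dj) mulrC ler_wpM2r//.
    by rewrite distrC; apply: HN => /=; exact: ltnW.
  rewrite ler_wpM2l ?(ltW e2)// (big_cat_nat (m := 1) (n := N1) _ Nm)//= lerDr.
  by rewrite sumr_ge0// => j _; rewrite divr_ge0 ?good_ge0 ?Dlam_ge0.
rewrite distrC -(ler_pM2r L0) -[X in _ * X <= _](gtr0_norm L0) -normrM.
rewrite mulrBl divfK ?gt_eqF//.
rewrite moment1_split//.
have tm0 := mulr_ge0 (good_ge0 good m) (t_ge0 m).
have := t_le m; have l1 := lam_gt0 (leqnn 1%N).
have hc : `|c * lam_harmonic m - c * ln (lam m)| <= c * (`|ln (lam 1)| + l).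
  rewrite -mulrBr normrM (ger0_norm c0) ler_wpM2l// ler_norml.
  have := ler_norm (ln (lam 1)); have := ler_norm (- ln (lam 1)); rewrite normrN.
  have := gap_ge1; lra.
have he : e / 2 * lam_harmonic m <= e / 2 * (ln (lam m) + (`|ln (lam 1)| + l)).
  rewrite ler_wpM2l ?(ltW e2)//.
  have := ler_norm (- ln (lam 1)); rewrite normrN; lra.
move: key hc; rewrite !ler_norml => /andP[k1 k2] /andP[c1 c2] tK.
move: LD; rewrite /D => LD.
by apply/andP; split; lra.
Qed.

End moments.

Lemma moment1_pinfty_ln (R : realType) (lam t : nat -> R) (alpha : R) :
  good_sequence lam -> 0 < alpha ->
  moment1 lam t m / ln (lam m) @[m --> \oo] --> alpha ->
  moment1 lam t m @[m --> \oo] --> +oo.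
Proof.
move=> good a0 /cvgrPdist_le/(_ (alpha / 2)).
rewrite divr_gt0// => /(_ isT) near_alpha.
apply/cvgryPge => A.
have /cvgryPge/(_ (1 + `|A| / (alpha / 2))) := cvg_ln_lam good.
apply: filterS2 near_alpha => m.
rewrite ler_norml => /andP[_ h] lnm.
have a2 : 0 < alpha / 2 by rewrite divr_gt0.
have ln0 : 0 < ln (lam m).
  by apply: lt_le_trans lnm; rewrite ltr_wpDr// divr_ge0// ltW.
have {}h : alpha / 2 <= moment1 lam t m / ln (lam m) by lra.
move: h; rewrite ler_pdivlMr//; apply: le_trans.
apply: le_trans (ler_norm A) _.
rewrite mulrC -ler_pdivrMr//; apply: le_trans lnm.
by rewrite lerDr.
Qed.

Lemma cvg_ln_level (R : realType) (lam : nat -> R) (l gamma : R) :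
  good_sequence lam -> (forall n, lam n.+1 - lam n <= l) -> 0 < gamma ->
  ln (lam (level lam (n%:R `^ gamma))) / ln n%:R @[n --> \oo] --> gamma.
Proof.
move=> good gap g0; have l1 := gap_ge1 good gap.
have lnoo : ln n%:R @[n --> \oo] --> (+oo : set_system R).
  apply/cvgryPge => A; apply: filterS (nbhs_infty_ger (expR A)) => n An.
  by rewrite -(expRK A) ler_ln ?posrE ?expR_gt0// (lt_le_trans (expR_gt0 A)).
apply/cvgrPdist_le => e e0.
have /cvgryPge/(_ (1 + ln (1 + l) / e)) := lnoo.
have /cvgnyPge/(_ 1%N) := cvg_level good g0.
apply: filterS3 (nbhs_infty_ge 1%N) => n /= n1 m1 lnn.
have n0 : 0 < n%:R :> R by rewrite ltr0n.
have p0 := powR_gt0 gamma n0.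
set m := level lam _ in m1 *; have lm0 := lam_gt0 good m1.
have lnl0 : 0 <= ln (1 + l) by apply: ln_ge0; lra.
have lnn0 : 0 < ln n%:R :> R.
  by apply: lt_le_trans lnn; rewrite ltr_wpDr// divr_ge0// ltW.
have up : ln (lam m) <= gamma * ln n%:R.
  by rewrite -ln_powR ler_ln ?posrE// lam_level_le// ltW.
have lo : gamma * ln n%:R <= ln (1 + l) + ln (lam m).
  have l1p : 0 < 1 + l by lra.
  rewrite -ln_powR -lnM ?posrE// ler_ln ?posrE// ?mulr_gt0//.
  apply: le_trans (lamS_le good gap m1).
  by rewrite ltW// lt_lam_levelS// ltW.
rewrite -(ler_pM2r lnn0) -[X in _ * X <= _](gtr0_norm lnn0) -normrM mulrBl.
rewrite divfK ?gt_eqF// ger0_norm; last by rewrite subr_ge0.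
have : ln (1 + l) <= e * ln n%:R.
  by rewrite mulrC -ler_pdivrMr//; apply: le_trans lnn; rewrite lerDr.
lra.
Qed.

(** * Sequences whose terms are independent of a coded past *)

Section cells.
Context d (T : measurableType d) (R : realType) (P : probability T R).
Implicit Types V : T -> nat.

Lemma measurable_ge_set (f : T -> R) (x : R) :
  measurable_fun setT f -> measurable [set w | x <= f w].
Proof.
move=> /(_ measurableT _ (measurable_itv `[x, +oo[%R)); rewrite setTI.
by congr measurable; apply/seteqP; split=> w /=; rewrite in_itv/= andbT.
Qed.

Lemma integral_const (c : R) : (\int[P]_w c%:E = c%:E)%E.
Proof.
rewrite integral_cst// -[RHS]mule1; congr (_ * _)%E; exact: probability_setT.
Qed.

(** A function that is constant on the cells of a countable measurable
    partition is measurable for any structure on its codomain. *)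
Lemma measurable_cells V (U : Type) (f : T -> U) (S : set U) :
  (forall v, measurable (V @^-1` [set v])) ->
  (forall w w', V w = V w' -> f w = f w') ->
  measurable (f @^-1` S).
Proof.
move=> mV fV.
rewrite (_ : _ @^-1` _ =
    \bigcup_(v in V @` (f @^-1` S)) (V @^-1` [set v])).
  by apply: bigcup_measurable => k _; exact: mV.
apply/seteqP; split=> [w Sw|w [v [w' Sw' Vw'] /= Vw]].
  by exists (V w) => //; exists w.
by rewrite /preimage /= (fV w w') // Vw.
Qed.

Lemma measurable_nat_fun V : (forall v, measurable (V @^-1` [set v])) ->
  measurable_fun setT V.
Proof.
by move=> mV _ S _; rewrite setTI; apply: (measurable_cells S mV).
Qed.

Lemma integral_cells V (f : T -> \bar R) :
  (forall v, measurable (V @^-1` [set v])) ->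
  measurable_fun setT f -> (forall w, (0 <= f w)%E) ->
  (\int[P]_w f w = \sum_(0 <= v <oo) \int[P]_(w in V @^-1` [set v]) f w)%E.
Proof.
move=> mV mf f0.
have VT : \bigcup_v (V @^-1` [set v]) = setT.
  by apply/seteqP; split=> // w _; exists (V w).
rewrite -[in LHS]VT ge0_integral_bigcup //; rewrite ?VT //.
apply/trivIsetP => i j _ _ ij; apply/seteqP; split=> // w [/= iE jE].
by move: ij; rewrite -iE jE eqxx.
Qed.

End cells.

(** The levels of V n are the cells of a countable partition: what is known
    at time n. The index J k is decided between times k and k.+1, and its
    conditional tail t is the same on every cell, so the J k are independent
    with P(J k > j) = t j. Independence is stated cell by cell because this is
    how the conditional law of B_(n+1) given the history is prescribed. *)
Record iid_past d (T : measurableType d) (R : realType) (P : probability T R)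
    (V J : nat -> T -> nat) (t : nat -> R) : Prop := {
  past_measurable : forall n v, measurable (V n @^-1` [set v]) ;
  past_index : forall n k w w',
    (k < n)%N -> V n w = V n w' -> J k w = J k w' ;
  past_index_gt0 : forall n w, (1 <= J n w)%N ;
  past_index_tail : forall n v j, (1 <= n)%N ->
    P (V n @^-1` [set v] `&` [set w | (j < J n w)%N]) =
    (P (V n @^-1` [set v]) * (t j)%:E)%E
}.

Section iid_past.
Context d (T : measurableType d) (R : realType) (P : probability T R).
Variables (V J : nat -> T -> nat) (t : nat -> R).
Hypothesis iid : iid_past P V J t.

Let mV := past_measurable iid.
Let VJ := past_index iid.
Let J0 := past_index_gt0 iid.
Let JP := past_index_tail iid.

Lemma measurable_J n S : measurable (J n @^-1` S).
Proof. by apply: (@measurable_cells _ _ (V n.+1)) => // w w'; exact: VJ. Qed.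

Lemma measurable_comp_J n (g : nat -> R) : measurable_fun setT (g \o J n).
Proof.
apply: measurableT_comp => //.
by apply: measurable_nat_fun => v; exact: measurable_J.
Qed.

Lemma cell_law n v j : (1 <= n)%N ->
  P (V n @^-1` [set v] `&` J n @^-1` [set j]) =
  (P (V n @^-1` [set v]) * (law t j)%:E)%E.
Proof.
move=> n1; case: j => [|j] /=.
  rewrite mule0 (_ : _ `&` _ = set0) ?measure0//.
  by apply/seteqP; split=> // w [_ /= Jw]; have := J0 n w; rewrite Jw.
have mC k : measurable (V n @^-1` [set v] `&` [set w | (k < J n w)%N]).
  apply: measurableI => //.
  by apply: (@measurable_J n [set i | (k < i)%N]).
rewrite (_ : _ `&` _ = (V n @^-1` [set v] `&` [set w | (j < J n w)%N]) `\`
   (V n @^-1` [set v] `&` [set w | (j.+1 < J n w)%N])); last first.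
  apply/seteqP; split=> w /=.
    by move=> [-> ->]; rewrite ltnS leqnn; split=> //; case; rewrite ltnn.
  move=> [[-> jJ] nJ]; split=> //; apply/eqP; rewrite eqn_leq jJ andbT leqNgt.
  by apply/negP => jJ'; apply: nJ.
rewrite measureD//; last by rewrite ltey_eq fin_num_measure.
rewrite [X in (_ - P X)%E]setIidr; last first.
  by move=> w [Vw jJ]; split=> //=; exact: ltnW.
transitivity (P (V n @^-1` [set v]) * (t j)%:E -
              P (V n @^-1` [set v]) * (t j.+1)%:E)%E.
  by congr (_ - _)%E; exact: JP.
by rewrite -muleBr// fin_num_measure.
Qed.

(** The expectation of g (J n) when g is constant beyond m, as a finite sum. *)
Definition law_mean (g : nat -> R) (m : nat) : R :=
  \sum_(1 <= j < m.+1) g j * law t j + g m.+1 * t m.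

(** Restricting to functions g that are constant beyond m replaces a series by
    finitely many indicators and the indicator of J n > m. *)
Lemma integral_cell n v (g : nat -> R) m : (1 <= n)%N ->
  (forall j, 0 <= g j) -> (forall j, (m < j)%N -> g j = g m.+1) ->
  (\int[P]_(w in V n @^-1` [set v]) (g (J n w))%:E =
   P (V n @^-1` [set v]) * (law_mean g m)%:E)%E.
Proof.
move=> n1 g0 gm.
pose f (j : nat) w := ((g j)%:E * (\1_(J n @^-1` [set j]) w)%:E : \bar R)%E.
pose f' w := ((g m.+1)%:E * (\1_[set w | (m < J n w)%N] w)%:E : \bar R)%E.
have mJ' : measurable [set w | (m < J n w)%N].
  by apply: (@measurable_J n [set i | (m < i)%N]).
have f0 j w : (0 <= f j w)%E by rewrite mule_ge0 // lee_fin.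
have f'0 w : (0 <= f' w)%E by rewrite mule_ge0 // lee_fin.
have mf j : measurable_fun (V n @^-1` [set v]) (f j).
  apply/measurable_funeM/measurable_EFinP/measurable_indic.
  exact: measurable_J.
have mf' : measurable_fun (V n @^-1` [set v]) f'.
  by apply/measurable_funeM/measurable_EFinP/measurable_indic.
under eq_integral => w _.
  rewrite (_ : (g (J n w))%:E = \sum_(1 <= j < m.+1) f j w + f' w)%E; last first.
    rewrite /f' /f indicE; case: (leqP (J n w) m) => [Jm|mJ].
      rewrite memNset ?mule0 ?adde0; last by rewrite /= ltnNge Jm.
      rewrite (bigD1_seq (J n w)) ?iota_uniq//=; last first.
        by rewrite mem_index_iota J0.
      rewrite indicE mem_set// mule1 big1 ?adde0// => j /eqP jJ.
      by rewrite indicE memNset ?mule0// => /= H; apply: jJ.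
    rewrite mem_set// mule1 big_nat big1 ?add0e ?gm// => j /andP[_ jm].
    rewrite indicE memNset ?mule0// => /= H.
    by move: mJ; rewrite H ltnNge -ltnS jm.
  over.
rewrite ge0_integralD//; last 2 first.
- by move=> w _; apply: sume_ge0.
- exact: emeasurable_sum.
rewrite ge0_integral_sum//.
have mean1 (c : R) (A : set T) : measurable A -> 0 <= c ->
   (\int[P]_(w in V n @^-1` [set v]) (c%:E * (\1_A w)%:E) =
    c%:E * P (V n @^-1` [set v] `&` A))%E.
  move=> mA c0; rewrite ge0_integralZl//.
  - by rewrite integral_indic// setIC.
  - exact/measurable_EFinP/measurable_indic.
rewrite mean1// JP//.
under eq_bigr do rewrite (mean1 _ _ (measurable_J _ _))// cell_law//.
have /fineK <- : P (V n @^-1` [set v]) \is a fin_num by rewrite fin_num_measure.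
under eq_bigr do rewrite -!EFinM.
rewrite -!EFinM sumEFin -EFinD; congr (_%:E).
rewrite /law_mean mulrDr mulr_sumr; congr (_ + _); last by rewrite mulrCA.
by apply: eq_bigr => j _; rewrite mulrCA.
Qed.

(** Independence of J n from the past: on each cell Z is a constant, and the
    mean of g (J n) is the same on all cells. *)
Lemma integral_mul_J n (Z : T -> R) (g : nat -> R) m : (1 <= n)%N ->
  (forall w w', V n w = V n w' -> Z w = Z w') -> (forall w, 0 <= Z w) ->
  (forall j, 0 <= g j) -> (forall j, (m < j)%N -> g j = g m.+1) ->
  (\int[P]_w (Z w * g (J n w))%:E = (law_mean g m)%:E * \int[P]_w (Z w)%:E)%E.
Proof.
move=> n1 ZV Z0 g0 gm.
have mZ : measurable_fun setT Z.
  by move=> _ S _; rewrite setTI; exact: (measurable_cells _ (mV n)).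
rewrite (integral_cells P (mV n)); last 2 first.
- by apply/measurable_EFinP/measurable_funM => //; exact: measurable_comp_J.
- by move=> w; rewrite lee_fin mulr_ge0.
rewrite (integral_cells P (mV n)); last 2 first.
- exact/measurable_EFinP.
- by move=> w; rewrite lee_fin.
rewrite -nneseriesZl; last first.
  by move=> v _; apply: integral_ge0 => w _; rewrite lee_fin.
apply: eq_eseriesr => v _.
have [->|/set0P[w0 /= Vw0]] := eqVneq (V n @^-1` [set v]) set0.
  by rewrite !integral_set0 mule0.
have Zw0 : {in V n @^-1` [set v], forall w, Z w = Z w0}.
  by move=> w /set_mem /= Vw; apply: ZV; rewrite Vw.
under eq_integral => w wv do rewrite (Zw0 w wv) EFinM.
rewrite ge0_integralZl//; last 3 first.
- apply/measurable_EFinP/measurable_funTS; exact: measurable_comp_J.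
- by move=> w _; rewrite lee_fin.
- by rewrite lee_fin.
rewrite (integral_cell _ n1 g0 gm).
under [X in (_ = _ * X)%E]eq_integral => w wv do rewrite (Zw0 w wv).
by rewrite integral_cst// muleA muleC.
Qed.

Lemma integral_J n (g : nat -> R) m : (1 <= n)%N ->
  (forall j, 0 <= g j) -> (forall j, (m < j)%N -> g j = g m.+1) ->
  (\int[P]_w (g (J n w))%:E = (law_mean g m)%:E)%E.
Proof.
move=> n1 g0 gm; under eq_integral do rewrite -[g _]mul1r.
rewrite (integral_mul_J (Z := fun=> 1) n1 _ _ g0 gm)//.
by rewrite integral_const mule1.
Qed.

Lemma integral_prod_J n (g : nat -> R) m :
  (forall j, 0 <= g j) -> (forall j, (m < j)%N -> g j = g m.+1) ->
  (\int[P]_w (\prod_(1 <= k < n.+1) g (J k w))%:E = (law_mean g m ^+ n)%:E)%E.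
Proof.
move=> g0 gm; elim: n => [|n IH].
  under eq_integral do rewrite big_geq//.
  exact: integral_const.
under eq_integral do rewrite big_nat_recr//=.
rewrite (integral_mul_J (m := m))//.
- by rewrite IH exprS EFinM.
- by move=> w w' Vw; apply: eq_big_nat => k /andP[_ kn]; congr g; exact: VJ Vw.
- by move=> w; rewrite prodr_ge0.
Qed.

(** Markov's inequality for the exponential of the sum, with the bound
    E e^a <= exp (E e^a - 1) on each of the n factors. *)
Lemma chernoff_J n (a : nat -> R) m (x : R) :
  (forall j, (m < j)%N -> a j = a m.+1) ->
  (P [set w | (x <= \sum_(1 <= k < n.+1) a (J k w))%R] <=
   (expR (n%:R * (law_mean (expR \o a) m - 1) - x))%:E)%E.
Proof.
move=> am.
have mS : measurable_fun setT (fun w => \sum_(1 <= k < n.+1) a (J k w)).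
  by apply: measurable_sum => k; exact: measurable_comp_J.
set A := [set w | _].
have mA : measurable A by exact: measurable_ge_set.
have -> : (P A = \int[P]_w (\1_A w)%:E)%E by rewrite integral_indic// setIT.
have mexp : measurable_fun setT
   (fun w => \prod_(1 <= k < n.+1) (expR \o a) (J k w)).
  rewrite (_ : (fun _ => _) =
     (fun w => expR (\sum_(1 <= k < n.+1) a (J k w)))).
    by apply: measurableT_comp mS; exact: measurable_expR.
  by apply/funext => w; rewrite (big_morph expR (@expRD _) (@expR0 _)).
apply: (@le_trans _ _ (\int[P]_w
   (expR (- x) * \prod_(1 <= k < n.+1) (expR \o a) (J k w))%:E)%E).
  apply: ge0_le_integral => //.
  - exact/measurable_EFinP/measurable_indic.
  - by apply/measurable_EFinP; apply: measurable_funM.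
  - move=> w _; rewrite lee_fin indicE.
    have [/set_mem wA|_] := boolP (w \in A).
      rewrite -(big_morph expR (@expRD _) (@expR0 _)) -expRD.
      by rewrite -[X in X <= _]expR0 ler_expR addrC subr_ge0; exact: wA.
    by rewrite mulr_ge0 ?expR_ge0// prodr_ge0// => k _; exact: expR_ge0.
under eq_integral do rewrite EFinM.
rewrite ge0_integralZl//.
- rewrite (@integral_prod_J _ (expR \o a) m)//; last 2 first.
  + by move=> j /=; exact: expR_ge0.
  + by move=> j mj /=; rewrite am.
  rewrite -EFinM lee_fin addrC expRD ler_wpM2l ?expR_ge0//.
  rewrite expRM_natl lerXn2r ?nnegrE ?expR_ge0//.
    have := @integral_J 1 _ m isT (fun j => expR_ge0 (a j)).
    move=> /(_ (fun j mj => congr1 expR (am j mj))) mE.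
    by rewrite -lee_fin -mE integral_ge0// => w _; rewrite lee_fin expR_ge0.
  by rewrite -{1}[law_mean _ _](subrKC 1) expR_ge1Dx.
- exact/measurable_EFinP.
- by move=> w _; rewrite lee_fin prodr_ge0// => k _; exact: expR_ge0.
Qed.

End iid_past.

(** * Deviation bounds *)

(** From exp x <= 1 / (1 - x) and (1 + x + 2 x^2) (1 - x) = 1 + x^2 (1 - 2 x). *)
Lemma expR_le_quadratic (R : realType) (x : R) :
  x <= 2^-1 -> expR x <= 1 + x + 2 * x ^+ 2.
Proof.
move=> x2; have x1 : 0 < 1 - x by lra.
have /(ler_wpM2l (expR_ge0 x)) : 1 - x <= expR (- x) by exact: expR_ge1Dx.
rewrite -expRD subrr expR0 -ler_pdivlMr// => /le_trans; apply.
rewrite ler_pdivrMr//.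
have : 0 <= x ^+ 2 * (1 - 2 * x) by rewrite mulr_ge0 ?sqr_ge0//; lra.
by rewrite !expr2; nra.
Qed.

(** The term (sqrt n)^4 / 4! of the exponential series gives a summable bound,
    here in a form that telescopes; 48 is 2 * 4!, as n + 1 <= 2 * n. *)
Lemma expR_sqrt_le (R : realType) (n : nat) : (1 <= n)%N ->
  expR (- Num.sqrt n%:R) <= 48 / (n%:R * n.+1%:R) :> R.
Proof.
move=> n1; have np : 0 < n%:R :> R by rewrite ltr0n.
rewrite expRN invf_ple ?posrE ?expR_gt0//; last first.
  by rewrite divr_gt0// mulr_gt0.
rewrite invf_div.
have := @expR_ge1Dxn R (Num.sqrt n%:R) 3 (sqrtr_ge0 _).
have -> : Num.sqrt n%:R ^+ 4 = n%:R ^+ 2 :> R.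
  by rewrite (exprM _ 2 2) sqr_sqrtr// ltW.
rewrite (_ : 4`!%:R = 24 :> R)//.
have : 1 <= n%:R :> R by rewrite ler1n.
by rewrite -[n.+1%:R]natr1; nra.
Qed.

(** The first Borel-Cantelli lemma for events of probability exp (- sqrt n). *)
Lemma ae_eventually_not d (T : measurableType d) (R : realType)
    (P : probability T R) (E : nat -> set T) :
  (forall n, measurable (E n)) ->
  (\forall n \near \oo, (P (E n) <= (expR (- Num.sqrt n%:R))%:E)%E) ->
  {ae P, forall w, \forall n \near \oo, ~ E n w}.
Proof.
move=> mE [N _ HN].
(* Shifting the events puts them in the range where the bound holds and the
   index is positive. *)
pose G n := E (n + N.+1)%N.
have mG n : measurable (G n) by exact: mE.
have PG n : (P (G n) <= (48 * (n.+1%:R^-1 - n.+2%:R^-1))%:E)%E.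
  apply: le_trans (HN _ _) _; first by rewrite /= addnS ltnW// ltnS leq_addl.
  rewrite lee_fin; apply: le_trans (expR_sqrt_le _ _) _; first by rewrite addnS.
  rewrite (_ : n.+1%:R^-1 - n.+2%:R^-1 = (n.+1%:R * n.+2%:R)^-1); last first.
    have : 0 < n.+1%:R :> R by []; rewrite -[n.+2%:R]natr1.
    by move: (n.+1%:R) => x x0; field; rewrite !gt_eqF//; lra.
  rewrite ler_pM2l// lef_pV2 ?posrE ?mulr_gt0 ?ltr0n ?addnS//.
  by rewrite ler_pM ?ler_nat ?ltnS ?leq_addr.
have lim0 : P (lim_sup_set G) = 0.
  apply: lim_sup_set_cvg0 => //.
  apply: (@le_lt_trans _ _ 48%:E); last exact: ltry.
  apply: lime_le; first by apply: is_cvg_nneseries.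
  near=> n; apply: le_trans (lee_sum _ _) _.
    by move=> i _; exact: PG.
  rewrite sumEFin lee_fin -mulr_sumr ler_piMr//.
  under eq_bigr do rewrite -opprB.
  rewrite sumrN (telescope_sumr (fun i => i.+1%:R^-1 : R))// opprB invr1.
  by rewrite gerBl invr_ge0.
exists (lim_sup_set G); split=> //.
  apply: bigcapT_measurable => n; apply: bigcup_measurable => k _; exact: mG.
move=> w /= nev n _; apply: contrapT => nG; apply: nev.
exists (n + N.+1)%N => // k /= nk Ek; apply: nG.
have Nk : (N.+1 <= k)%N by exact: leq_trans (leq_addl _ _) nk.
exists (k - N.+1)%N => /=; last by rewrite /G subnK.
by rewrite -(leq_add2r N.+1) subnK.
Unshelve. all: by end_near. Qed.

Section deviations.
Context d (T : measurableType d) (R : realType) (P : probability T R).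
Variables (V J : nat -> T -> nat) (lam t : nat -> R).
Hypothesis iid : iid_past P V J t.
Hypothesis good : good_sequence lam.
Hypothesis t0 : t 0%N = 1.
Hypothesis t_noninc : forall j, t j.+1 <= t j.

Lemma law_ge0 j : 0 <= law t j.
Proof. by case: j => //= j; rewrite subr_ge0. Qed.

(** The total mass is 1, so the mean of g - 1 is that of g minus 1. *)
Lemma mean_sub1 (g : nat -> R) m :
  law_mean t g m - 1 =
  \sum_(1 <= j < m.+1) (g j - 1) * law t j + (g m.+1 - 1) * t m.
Proof.
have -> : \sum_(1 <= j < m.+1) (g j - 1) * law t j =
    \sum_(1 <= j < m.+1) g j * law t j - (1 - t m).
  have := sum_law t (fun=> 1) m; rewrite t0 !mul1r => e.
  transitivity (\sum_(1 <= j < m.+1) (g j * law t j - 1 * law t j)).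
    by apply: eq_bigr => j _; rewrite mulrBl.
  rewrite sumrB e; under [X in _ - (_ + X) = _]eq_bigr do rewrite subrr mul0r.
  by rewrite big1_eq addr0.
by rewrite /law_mean; ring.
Qed.

Local Notation trunc := (trunc lam).

Definition trunc_sum m n w : R := \sum_(1 <= k < n.+1) trunc m (J k w).

Definition exceedances m n w : R := \sum_(1 <= k < n.+1) ((m < J k w)%N)%:R.

(** The sign sg = 1 or -1 treats the upper and the lower deviations at once. *)
Lemma trunc_sum_deviation (sg s e : R) m n : sg ^+ 2 = 1 -> 0 <= s ->
  s * lam m <= 2^-1 ->
  (P [set w | (n%:R * s * (sg + e) * moment1 lam t m <=
               sg * s * trunc_sum m n w)%R]
   <= (expR (n%:R * s * (2 * s * moment2 lam t m - e * moment1 lam t m)))%:E)%E.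
Proof.
move=> sg2 s0 sm.
pose a j := sg * s * trunc m j.
have am j : (m < j)%N -> a j = a m.+1.
  by move=> mj; rewrite /a /trunc leqNgt mj ltnn.
have aE w : sg * s * trunc_sum m n w = \sum_(1 <= k < n.+1) a (J k w).
  by rewrite /trunc_sum mulr_sumr.
under eq_set do rewrite aE.
apply: le_trans (chernoff_J iid _ _ am) _.
rewrite lee_fin ler_expR.
rewrite (_ : n%:R * s * (2 * s * moment2 lam t m - e * moment1 lam t m) =
  n%:R * (sg * s * moment1 lam t m + 2 * s ^+ 2 * moment2 lam t m) -
  n%:R * s * (sg + e) * moment1 lam t m); last by ring.
rewrite lerD2r ler_wpM2l// mean_sub1.
rewrite /= {2}/a /trunc ltnn mulr0 expR0 subrr mul0r addr0.
rewrite /moment1 /moment2 !mulr_sumr -big_split/=.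
apply: ler_sum_nat => j /andP[j1]; rewrite ltnS => jm.
rewrite /a /trunc jm 2!mulrA -mulrDl ler_wpM2r ?law_ge0// lerBlDl.
have -> : 1 + (sg * s * lam j + 2 * s ^+ 2 * lam j ^+ 2) =
   1 + sg * s * lam j + 2 * (sg * s * lam j) ^+ 2.
  by rewrite !exprMn sg2 mul1r; ring.
apply: expR_le_quadratic.
apply: le_trans sm; rewrite -mulrA.
have : s * lam j <= s * lam m by rewrite ler_wpM2l// good_le.
have := mulr_ge0 s0 (good_ge0 good j).
have sg1 : sg <= 1 by move: sg2; rewrite expr2; nra.
by nra.
Qed.

Lemma exceedances_deviation m n x :
  (P [set w | (x <= exceedances m n w)%R] <=
   (expR (n%:R * ((expR 1 - 1) * t m) - x))%:E)%E.
Proof.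
pose a j : R := ((m < j)%N)%:R.
have am j : (m < j)%N -> a j = a m.+1 by move=> mj; rewrite /a mj ltnS leqnn.
apply: le_trans (chernoff_J iid n x am) _.
rewrite lee_fin ler_expR lerD2r ler_wpM2l// mean_sub1.
rewrite /= {2}/a ltnS leqnn big_nat big1 ?add0r// => j /andP[_].
by rewrite ltnS /a ltnNge => -> /=; rewrite expR0 subrr mul0r.
Qed.

Lemma measurable_trunc_sum m n : measurable_fun setT (trunc_sum m n).
Proof.
by apply: measurable_sum => k; exact: (measurable_comp_J iid k (trunc m)).
Qed.

Lemma measurable_exceedances m n : measurable_fun setT (exceedances m n).
Proof.
apply: measurable_sum => k.
exact: (measurable_comp_J iid k (fun j => ((m < j)%N)%:R)).
Qed.

End deviations.

(** * Strong law for trimmed sums *)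

Section strong_law.
Context d (T : measurableType d) (R : realType) (P : probability T R).
Variables (V J : nat -> T -> nat) (lam t : nat -> R) (l K : R).
Hypothesis iid : iid_past P V J t.
Hypothesis good : good_sequence lam.
Hypothesis gap : forall n, lam n.+1 - lam n <= l.
Hypothesis t0 : t 0%N = 1.
Hypothesis t_ge0 : forall j, 0 <= t j.
Hypothesis t_noninc : forall j, t j.+1 <= t j.
Hypothesis t_le : forall j, lam j * t j <= K.
Hypothesis moment1_oo : moment1 lam t m @[m --> \oo] --> +oo.
Variables (gamma beta : R).
Hypothesis gamma0 : 0 < gamma.
Hypothesis gamma2 : gamma < 2^-1.
Hypothesis beta_gt : (expR 1 - 1) * ((1 + l) * K + l) + 1 < beta.

Local Notation M n := (n%:R `^ gamma).
Local Notation m n := (level lam (M n)).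
Local Notation mu n := (moment1 lam t (m n)).

Lemma M_gt0 n : (1 <= n)%N -> 0 < M n.
Proof. by move=> n1; rewrite powR_gt0// ltr0n. Qed.

Lemma divM n : (1 <= n)%N -> n%:R / M n = n%:R `^ (1 - gamma).
Proof.
move=> n1; rewrite powRB ?powRr1//.
by rewrite pnatr_eq0 -lt0n n1 implybT.
Qed.

(** This is where gamma < 1/2 enters. *)
Lemma sqrt_le_divM n : (1 <= n)%N -> Num.sqrt n%:R <= n%:R / M n.
Proof.
move=> n1; rewrite divM// -powR12_sqrt//; apply: ler_powR; first by rewrite ler1n.
by have := gamma2; lra.
Qed.

Lemma cvg_mu : mu n @[n --> \oo] --> +oo.
Proof. by apply: cvg_comp moment1_oo; exact: cvg_level. Qed.

(** With s = 1 / (2 M) the exponent in the deviation bound is at most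
    n / (2 M) * (K2 - e * mu), where K2 bounds the second moment over M; it is
    below - n / M as soon as e * mu >= K2 + 2. *)
Lemma ae_trunc_sum (sg e : R) : sg ^+ 2 = 1 -> 0 < e ->
  {ae P, forall w, \forall n \near \oo,
    sg * trunc_sum J lam (m n) n w < (sg + e) * (n%:R * mu n)}.
Proof.
move=> sg2 e0.
pose s n : R := (2 * M n)^-1.
pose E n := [set w | n%:R * s n * (sg + e) * mu n <=
                     sg * s n * trunc_sum J lam (m n) n w].
have : {ae P, forall w, \forall n \near \oo, ~ E n w}.
  apply: ae_eventually_not => [n|].
    apply: measurable_ge_set; apply: measurable_funM => //.
    exact: (measurable_trunc_sum lam iid).
  have /cvgryPge/(_ ((moment2_const l K + 2) / e)) := cvg_mu.
  apply: filterS2 (nbhs_infty_ge 1%N) => n /= n1 mun.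
  have M0 := M_gt0 n1; have s0 : 0 < s n by rewrite invr_gt0 mulr_gt0.
  have lamM : lam (m n) <= M n by rewrite lam_level_le// ltW.
  have sM : s n * M n = 2^-1 by rewrite /s invfM -mulrA mulVf ?mulr1// gt_eqF.
  have sm : s n * lam (m n) <= 2^-1 by rewrite -sM ler_wpM2l// ltW.
  have := trunc_sum_deviation iid good t0 t_noninc e n sg2 (ltW s0) sm.
  move=> /le_trans; apply.
  rewrite lee_fin ler_expR.
  have := moment2_le good gap t0 t_ge0 t_le (m n).
  move: mun; rewrite ler_pdivrMr// => mun m2.
  have K2 : 0 <= moment2_const l K.
    have := gap_ge1 good gap; have := tail_const_ge0 good t_le.
    by rewrite /moment2_const; nra.
  have h : 2 * s n * moment2 lam t (m n) <= moment2_const l K.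
    have : s n * moment2 lam t (m n) <= moment2_const l K * (s n * lam (m n)).
      by rewrite mulrCA ler_wpM2l// ltW.
    move=> /le_trans/(_ (ler_wpM2l K2 sm)); rewrite -mulrA.
    by move: (s n * _) (moment2_const _ _) => x c; lra.
  have nsE : n%:R / M n = 2 * (n%:R * s n).
    by rewrite /s; field; rewrite gt_eqF.
  have := sqrt_le_divM n1; rewrite nsE.
  have : 0 <= n%:R * s n by rewrite mulr_ge0// ltW.
  by move: (n%:R * s n) => x x0; nra.
apply: filterS => w; apply: filterS2 (nbhs_infty_ge 1%N) => n /= n1 nE.
have s0 : 0 < s n by rewrite invr_gt0 mulr_gt0// M_gt0.
rewrite -(ltr_pM2l s0) ltNge; apply/negP => h; apply: nE; rewrite /E /=.
by move: h; congr (_ <= _); ring.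
Qed.

(** The expected number of exceedances is n * t (m n), which [lamS_tail]
    bounds by a constant times n / M = n^(1-gamma). *)
Lemma ae_exceedances : {ae P, forall w, \forall n \near \oo,
  exceedances R J (m n) n w < beta * n%:R `^ (1 - gamma)}.
Proof.
pose E n := [set w | beta * n%:R `^ (1 - gamma) <= exceedances R J (m n) n w].
suff : {ae P, forall w, \forall n \near \oo, ~ E n w}.
  apply: filterS => w; apply: filterS => n /= nE.
  by rewrite ltNge; apply/negP.
apply: ae_eventually_not => [n|].
  by apply: measurable_ge_set; exact: measurable_exceedances iid _ _.
apply: filterS (nbhs_infty_ge 1%N) => n /= n1.
apply: le_trans (exceedances_deviation iid t0 (m n) n _) _.
rewrite lee_fin ler_expR -divM//.
have M0 := M_gt0 n1; have r0 := sqrt_le_divM n1.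
have := lamS_tail good gap t0 t_ge0 t_le (m n).
have : M n * t (m n) <= lam (m n).+1 * t (m n).
  by rewrite ler_wpM2r// ltW// lt_lam_levelS// ltW.
move=> /le_trans h /h {}h.
have nE : n%:R * ((expR 1 - 1) * t (m n)) =
    n%:R / M n * ((expR 1 - 1) * (M n * t (m n))).
  by field; rewrite gt_eqF.
have ex0 : 0 <= expR 1 - 1 :> R by rewrite subr_ge0 -expR0 ler_expR.
have := ler_wpM2l ex0 h; rewrite nE; move: r0.
have : 0 <= n%:R / M n by rewrite divr_ge0// ltW.
by move: (n%:R / M n) beta_gt => x b x0; nra.
Qed.

Variable Z : nat -> T -> R.
Hypothesis Z0 : forall k w, (1 <= k)%N -> 0 <= Z k w.
Hypothesis ZJ : forall k w, (1 <= k)%N ->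
  Z k w <= lam (J k w) <= Z k w + l.

Lemma ae_trimmed_sum : {ae P, forall w,
  trimmed_sum Z (trim_rank beta gamma n) n w / (n%:R * mu n)
    @[n --> \oo] --> (1 : R)}.
Proof.
have l1 := gap_ge1 good gap.
have beta1 : 1 < beta.
  have h1 : 0 <= expR 1 - 1 :> R by rewrite subr_ge0 -expR0 ler_expR.
  have h2 : 0 <= (1 + l) * K + l by have := tail_const_ge0 good t_le; nra.
  by apply: le_lt_trans beta_gt; rewrite lerDr mulr_ge0.
have aeT sg : sg ^+ 2 = 1 -> {ae P, forall w p, \forall n \near \oo,
    sg * trunc_sum J lam (m n) n w < (sg + p.+1%:R^-1) * (n%:R * mu n)}.
  by move=> sg2; apply: ae_foralln => p; apply: ae_trunc_sum.
apply: filterS3 (aeT 1 (expr1n _ _)) (aeT (-1) (sqrr_sign _ 1)) ae_exceedances.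
move=> w Tup Tlo exc; apply/cvgrPdist_le => e e0.
have e2 : 0 < e / 2 by rewrite divr_gt0.
have /cvgrPdist_le/(_ _ e2)[p _ /(_ p (leqnn p))] := @cvg_harmonic R.
rewrite sub0r normrN /harmonic/= ger0_norm ?invr_ge0// => pe.
have /cvgryPge/(_ (2 / e * (beta + 1 + l))) mu_ge := cvg_mu.
apply: filterS (filterI (filterI (Tup p) (Tlo p))
  (filterI (filterI exc (nbhs_infty_ge 1%N)) mu_ge)) => n.
move=> [[T1 T2] [[excn /= n1] mun]].
have M0 := M_gt0 n1; have n0 : 0 < n%:R :> R by rewrite ltr0n.
have /andP[r1 r2] := trim_rank_bounds gamma n (ltW (lt_trans ltr01 beta1)).
have := @trimmed_trunc_sum _ lam (Z ^~ w) (J ^~ w) l (le_trans ler01 l1) good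
  (fun k => @Z0 k w) (fun k => @ZJ k w) (M n) n (trim_rank beta gamma n) (ltW M0)
  (le_trans (ltW excn) r1).
rewrite -/(trunc_sum J lam (m n) n w) -/(trimmed_sum Z _ n w) => ST.
have Mn : M n <= n%:R by rewrite ler1_powR ?ler1n//; have := gamma2; lra.
have rM : (trim_rank beta gamma n)%:R * M n <= (beta + 1) * n%:R.
  apply: le_trans (ler_wpM2r (ltW M0) r2) _.
  by rewrite -divM// mulrDl mul1r mulrDl mul1r -mulrA divfK ?gt_eqF// lerD2l.
have mu0 : 0 < mu n.
  by apply: lt_le_trans mun; rewrite mulr_gt0// ?divr_gt0//; lra.
have nmu0 : 0 < n%:R * mu n by rewrite mulr_gt0.
have small : (beta + 1 + l) * n%:R <= e / 2 * (n%:R * mu n).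
  rewrite mulrCA mulrC ler_pM2l//; have := ler_wpM2l (ltW e2) mun.
  by rewrite mulrA mulrA mulfVK ?mulfV ?mul1r// gt_eqF.
have pnmu : p.+1%:R^-1 * (n%:R * mu n) <= e / 2 * (n%:R * mu n).
  by rewrite ler_wpM2r// ltW.
rewrite distrC -(ler_pM2r nmu0) -[X in _ * X <= _](gtr0_norm nmu0) -normrM.
rewrite mulrBl divfK ?gt_eqF// mul1r.
move: ST small rM T1 T2 pnmu; rewrite -/(trimmed_sum Z _ n w).
set S := trimmed_sum _ _ _ _; set U := trunc_sum _ _ _ _ _.
move: (n%:R * mu n) (_ * M n) (p.+1%:R^-1) => x y q.
rewrite !ler_norml => /andP[ST1 ST2] small rM T1 T2 pnmu.
by apply/andP; split; lra.
Qed.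

Lemma truncated_meanE (X : nat -> T -> R) n :
  (forall k w, (1 <= k)%N -> X k w = lam (J k w)) ->
  truncated_mean P X gamma n = n%:R * mu n.
Proof.
move=> XE; rewrite /truncated_mean.
transitivity (\sum_(1 <= k < n.+1) mu n); last first.
  by rewrite sumr_const_nat subSS subn0 mulr_natl.
apply: eq_big_nat => k /andP[k1 _]; rewrite unlock.
have -> : (\int[P]_w (X k w * \1_[set v | X k v <= M n] w)%:E =
           \int[P]_w (trunc lam (m n) (J k w))%:E)%E.
  apply: eq_integral => w _; rewrite indicE /trunc leq_level ?powR_ge0// -XE//.
  case: ifPn => h; first by rewrite mem_set// mulr1.
  by rewrite memNset ?mulr0//; apply/negP.
rewrite (integral_J iid (m := m n))//.
- rewrite /= /law_mean {2}/trunc ltnn mul0r addr0.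
  by apply: eq_big_nat => j /andP[_]; rewrite ltnS /trunc => ->.
- by move=> j; rewrite /trunc; case: ifP => // _; exact: good_ge0.
- by move=> j mj; rewrite /trunc leqNgt mj ltnn.
Qed.

End strong_law.

(** * The index process of an Oppenheim expansion *)

(** Turns an almost sure property into a property of a cell of positive
    probability, when it depends on the cell only. *)
Lemma ae_exists d (T : measurableType d) (R : realType) (P : probability T R)
    (A : set T) (Q : T -> Prop) : measurable A -> (0 < P A)%E ->
  {ae P, forall w, Q w} -> exists w, A w /\ Q w.
Proof.
move=> mA PA aeQ; apply: contrapT => nex.
suff PA0 : P A = 0 by rewrite PA0 ltxx in PA.
apply: measure_negligible => //; apply: negligibleS aeQ => w Aw /= Qw.
by apply: nex; exists w.
Qed.

Lemma fine_div (R : realType) (a b : \bar R) :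
  a \is a fin_num -> b \is a fin_num -> b != 0%E ->
  a = (b * (fine a / fine b)%:E)%E.
Proof.
case: a b => [a| |] [b| |]//= _ _ b0.
by rewrite -EFinM mulrCA mulfV ?mulr1//; apply: contraNneq b0 => ->.
Qed.

Section past.
Context d (T : measurableType d) (R : realType) (P : probability T R).
Variables (B : nat -> {RV P >-> nat}) (phi : nat -> nat -> R).
Variables (y : forall n : nat, n.-tuple nat -> R).
Variables (F : cumulativeBounded (0 : R) (1 : R)) (lam : nat -> R).
Hypothesis opp : oppenheim_expansion B phi y F.
Hypothesis good : good_sequence lam.
Hypothesis int_lam : forall j n, (1 <= n)%N -> {ae P, forall w,
  lam j * phi n (B n w) + (lam j - 1) * opp_Y B y n w * phi n (B n w)
    \is a Num.int}.

Local Notation RR := (opp_R B phi y).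

(** Numbering the tuples (B_1, ..., B_n) makes the events B_1 = h_1, ...,
    B_n = h_n the cells of a partition indexed by nat. *)
Definition past_code (n : nat) (w : T) : nat :=
  pickle [tuple B i.+1 w | i < n].

(** The value at n = 0 is a placeholder, chosen positive and constant so that
    all indices, 0 included, satisfy the conditions of [iid_past]. *)
Definition lam_index (n : nat) (w : T) : nat :=
  if n is 0 then 1%N else good_index lam (RR n w).

Definition index_tail (j : nat) : R := if j is 0 then 1 else F (lam j)^-1.

Lemma past_code_eq n w w' : past_code n w = past_code n w' <->
  (forall j, (1 <= j <= n)%N -> B j w = B j w').
Proof.
split=> [/(pcan_inj pickleK) e [//|j] /= jn|e].
  by have := congr1 (fun t => tnth t (Ordinal jn)) e; rewrite !tnth_mktuple.
by congr pickle; apply: eq_mktuple => i; apply: e; rewrite /= ltn_ord.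
Qed.

Lemma past_codeE n w : past_code n @^-1` [set past_code n w] =
  opp_past B n (fun j => B j w).
Proof. by apply/seteqP; split=> w' /= /past_code_eq. Qed.

Lemma measurable_opp_past n h : measurable (opp_past B n h).
Proof.
rewrite (_ : opp_past B n h =
    \bigcap_(j in [set j | (1 <= j <= n)%N]) (B j @^-1` [set h j])).
  apply: bigcap_measurableType => j _.
  by rewrite -[X in measurable X]setTI; exact: measurable_funP.
by apply/seteqP; split=> w /= H j; exact: H.
Qed.

Lemma measurable_past_code n v : measurable (past_code n @^-1` [set v]).
Proof.
have [->//|/set0P[w /= <-]] := eqVneq (past_code n @^-1` [set v]) set0.
by rewrite past_codeE; exact: measurable_opp_past.
Qed.

Lemma opp_Y_eq n w w' : past_code n w = past_code n w' ->
  opp_Y B y n w = opp_Y B y n w'.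
Proof.
move=> /past_code_eq e; congr y; apply: eq_mktuple => i.
by apply: e; rewrite /= ltn_ord.
Qed.

Lemma lam_index_eq n k w w' : (k < n)%N -> past_code n w = past_code n w' ->
  lam_index k w = lam_index k w'.
Proof.
case: k => [//|k] kn /past_code_eq e; rewrite /lam_index /opp_R.
rewrite (@opp_Y_eq k.+1 w w') ?e ?(ltnW kn)//.
by apply/past_code_eq => j /andP[j0 jk]; apply: e; rewrite j0 (leq_trans jk)// ltnW.
Qed.

Lemma phi_gt0 n w : (1 <= n)%N -> 0 < phi n (B n w).
Proof. by move=> n1; rewrite (opp_phi_gt0 opp)// (opp_B_gt0 opp). Qed.

Lemma opp_Y_ge0 n w : (1 <= n)%N -> 0 <= opp_Y B y n w.
Proof.
move=> n1; apply: (opp_y_ge0 opp) => // i.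
by rewrite tnth_mktuple (opp_B_gt0 opp).
Qed.

Lemma opp_R_ge0 n w : (1 <= n)%N -> 0 <= RR n w.
Proof.
move=> n1; have := phi_gt0 w n1; have := opp_Y_ge0 w n1 => Y0 p0.
by rewrite /opp_R divr_ge0// ?addr_ge0 ?mulr_ge0 ?addr_ge0// ?ltW.
Qed.

Lemma lam_indexE n w : (1 <= n)%N -> lam_index n w = good_index lam (RR n w).
Proof. by case: n. Qed.

Lemma lam_index_gt0 n w : (1 <= lam_index n w)%N.
Proof. by case: n => [//|n]; apply: good_index_gt0 => //; apply: opp_R_ge0. Qed.

(** The threshold for B_(n+1) is the quantity assumed to be an integer. *)
Lemma le_opp_R j n w : (1 <= n)%N -> (lam j <= RR n w) =
  (lam j * phi n (B n w) + (lam j - 1) * opp_Y B y n w * phi n (B n w)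
    <= (B n.+1 w)%:R).
Proof.
move=> n1; have := phi_gt0 w n1; have := opp_Y_ge0 w n1 => Y0 p0.
rewrite /opp_R ler_pdivlMr; last by rewrite mulr_gt0// ltr_wpDr.
by apply/idP/idP; lra.
Qed.

Lemma cvg_F_delta n h k z : 0 < phi n h -> 0 <= z -> (1 <= k)%N ->
  F (opp_delta phi n h (k + i) z) @[i --> \oo] --> (0 : R).
Proof.
move=> p0 z0 k1.
suff: F (opp_delta phi n h (k + i) z) @[i --> \oo] --> F 0 by rewrite (opp_F0 opp).
apply: (cvg_at_rightP _ _ _).1; first exact: cumulative_is_right_continuous.
have kp i : 0 < (k + i)%:R + phi n h * z.
  by rewrite ltr_wpDr ?mulr_ge0 ?(ltW p0)// ltr0n addn_gt0 k1.
have c0 : 0 < phi n h * (1 + z) by rewrite mulr_gt0// ltr_wpDr.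
split=> [i|]; first by rewrite divr_gt0.
apply: (@squeeze_cvgr _ _ _ _ (fun=> 0) (fun i => phi n h * (1 + z) * i.+1%:R^-1)).
- near=> i; rewrite divr_ge0 ?(ltW c0) ?(ltW (kp _))//=.
  rewrite ler_pM2l// lef_pV2 ?posrE//.
  by rewrite ler_wpDr ?mulr_ge0 ?(ltW p0)// ler_nat -add1n leq_add2r.
- exact: cvg_cst.
- rewrite -(mulr0 (phi n h * (1 + z))).
  by apply: cvgM; [exact: cvg_cst|exact: cvg_harmonic].
Unshelve. all: by end_near. Qed.

(** The conditional probabilities of B_(n+1) = k, k+1, ... telescope, and what
    is left vanishes in the limit because F is right-continuous at 0. *)
Lemma past_tail n h k : (1 <= n)%N -> (1 <= h 1)%N ->
  (forall j, (2 <= j <= n)%N -> phi j.-1 (h j.-1) <= (h j)%:R) ->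
  (0 < P (opp_past B n h))%E -> 0 < phi n (h n) -> phi n (h n) <= k%:R ->
  0 <= y [tuple h i.+1 | i < n] ->
  P (opp_past B n h `&` [set w | (k <= B n.+1 w)%N]) =
  (P (opp_past B n h) *
    (F (opp_delta phi n (h n) k (y [tuple h i.+1 | i < n])))%:E)%E.
Proof.
move=> n1 h1 hphi PA p0 pk y0; set A := opp_past B n h; set z := y _ in y0 *.
have k1 : (1 <= k)%N by rewrite -(ltr0n R); exact: lt_le_trans pk.
have mA : measurable A by exact: measurable_opp_past.
have mB i : measurable [set w | B n.+1 w = i].
  rewrite -[X in measurable X]/(B n.+1 @^-1` [set i]) -[X in measurable X]setTI.
  exact: measurable_funP.
pose D i := F (opp_delta phi n (h n) (k + i) z).
have slice i : P (A `&` [set w | B n.+1 w = (k + i)%N]) =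
    (P A * (D i - D i.+1)%:E)%E.
  (* The history h followed by B_(n+1) = k + i. *)
  pose h' j := if j == n.+1 then (k + i)%N else h j.
  have h'E j : (j <= n)%N -> h' j = h j by move=> jn; rewrite /h' ltn_eqF.
  have AE : opp_past B n h' = A.
    apply/seteqP; split=> w /= Hw j jn; have := Hw j jn; rewrite h'E//;
      by case/andP: jn.
  have yE : [tuple h' i.+1 | i < n] = [tuple h i.+1 | i < n].
    by apply: eq_mktuple => l; rewrite h'E.
  have h'S : h' n.+1 = (k + i)%N by rewrite /h' eqxx.
  have h'1 : (1 <= h' 1)%N by rewrite h'E.
  have h'phi j : (2 <= j <= n.+1)%N -> phi j.-1 (h' j.-1) <= (h' j)%:R.
    move=> /andP[j2]; rewrite leq_eqVlt => /predU1P[->|jn].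
      by rewrite h'S /= h'E// (le_trans pk)// ler_nat leq_addr.
    by rewrite !h'E ?hphi ?j2// (leq_trans (leq_pred _)).
  have PA' : (0 < P (opp_past B n h'))%E by rewrite AE.
  have := opp_cond opp n1 h'1 h'phi PA'; rewrite /= AE yE h'S (h'E n (leqnn n)) => H.
  rewrite /D addnS -H /cond_prob setIC; apply: fine_div.
  - by rewrite fin_num_measure//; exact: measurableI.
  - by rewrite fin_num_measure.
  - by rewrite gt_eqF.
have AB : \bigcup_i (A `&` [set w | B n.+1 w = (k + i)%N]) =
    A `&` [set w | (k <= B n.+1 w)%N].
  apply/seteqP; split=> w.
    by move=> [i _ [Aw /= ->]]; split=> //=; rewrite leq_addr.
  by move=> [Aw /= kB]; exists (B n.+1 w - k)%N => //; split=> //=; rewrite subnKC.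
rewrite -AB.
have sum_cvg : \sum_(0 <= i < N) P (A `&` [set w | B n.+1 w = (k + i)%N])
    @[N --> \oo] --> P (\bigcup_i (A `&` [set w | B n.+1 w = (k + i)%N])).
  apply: measure_semi_sigma_additive.
  - by move=> i; exact: measurableI.
  - apply/trivIsetP => i j _ _ ij; apply/seteqP; split=> // w [[_ /= Bi] [_ /= Bj]].
    by move: ij; rewrite -(eqn_add2l k) -Bi -Bj eqxx.
  - by apply: bigcupT_measurable => i; exact: measurableI.
have PAf : P A = (fine (P A))%:E by rewrite fineK// fin_num_measure.
have lim_cvg : \sum_(0 <= i < N) P (A `&` [set w | B n.+1 w = (k + i)%N])
    @[N --> \oo] --> (fine (P A) * D 0%N)%:E.
  rewrite (_ : (fun N => _) = (fun N => (fine (P A) * (D 0%N - D N))%:E)); last first.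
    apply/funext => N; under eq_bigr do rewrite slice PAf -EFinM.
    rewrite sumEFin -mulr_sumr -opprB -(telescope_sumr D (leq0n N)) -sumrN.
    by congr (_ * _)%:E; apply: eq_bigr => i _; rewrite opprB.
  apply: cvg_EFin; first by near=> N.
  rewrite -{2}[D 0%N]subr0; apply: cvgM; first exact: cvg_cst.
  by apply: cvgB; [exact: cvg_cst|exact: cvg_F_delta].
rewrite (cvg_unique _ sum_cvg lim_cvg)//.
by rewrite /D addn0 EFinM -PAf.
Unshelve. all: by end_near. Qed.

(** On a cell of positive probability the threshold is an integer k, and the
    tail at k is F (1 / lam j) since
    k + phi * Y = lam j * phi * (1 + Y): the history cancels out. *)
Lemma lam_index_tail n v j : (1 <= n)%N ->
  P (past_code n @^-1` [set v] `&` [set w | (j < lam_index n w)%N]) =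
  (P (past_code n @^-1` [set v]) * (index_tail j)%:E)%E.
Proof.
move=> n1; case: j => [|j].
  rewrite mule1; congr (P _); apply/seteqP; split=> w; first by case.
  by move=> vw; split=> //=; exact: lam_index_gt0.
have [->|/set0P[w0 /= <-]] := eqVneq (past_code n @^-1` [set v]) set0.
  by rewrite set0I measure0 mul0e.
rewrite past_codeE; set A := opp_past B n _.
have mA : measurable A by exact: measurable_opp_past.
have [PA0|PA0] := eqVneq (P A) 0%E.
  rewrite PA0 mul0e; apply/eqP; rewrite -measure_le0 -PA0.
  have mJ : measurable [set w | (j.+1 < lam_index n w)%N].
    apply: (measurable_cells [set i | (j.+1 < i)%N]
      (measurable_past_code n.+1)) => w w'.
    exact: lam_index_eq.
  apply: le_measure; [apply/mem_set|exact/mem_set|exact: subIsetl].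
  exact: measurableI.
have PA : (0 < P A)%E by rewrite lt0e PA0 measure_ge0.
have [w1 [Aw1 [phi_le /natrP]]] : exists w, A w /\
    ((forall i, (1 <= i)%N -> phi i (B i w) <= (B i.+1 w)%:R) /\
     lam j.+1 * phi n (B n w) + (lam j.+1 - 1) * opp_Y B y n w * phi n (B n w)
       \is a Num.nat).
  have aephi : {ae P, forall w i, (1 <= i)%N -> phi i (B i w) <= (B i.+1 w)%:R}.
    apply: ae_foralln => -[|i]; first by near=> w.
    by apply: filterS (opp_B_ge opp (ltn0Sn i)) => w H _.
  apply: (ae_exists mA PA); apply: filterS2 aephi (int_lam j.+1 n1) => w phiw intw.
  split=> //; rewrite natrEint intw/=.
  have p0 := phi_gt0 w n1; have Y0 := opp_Y_ge0 w n1.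
  have l1 := good_ge1 good (ltn0Sn j).
  by rewrite addr_ge0 ?mulr_ge0 ?subr_ge0 ?(ltW p0)// (le_trans ler01).
move=> [k kE].
have p0 := phi_gt0 w0 n1; have Y0 := opp_Y_ge0 w0 n1.
have l1 := good_ge1 good (ltn0Sn j).
have cell w : A w -> past_code n w = past_code n w0 by move/past_code_eq.
have cellB w : A w -> B n w = B n w0 by move=> Aw; apply: Aw; rewrite n1 leqnn.
have cellY w : A w -> opp_Y B y n w = opp_Y B y n w0 by move/cell/opp_Y_eq.
rewrite (cellB _ Aw1) (cellY _ Aw1) in kE.
have -> : A `&` [set w | (j.+1 < lam_index n w)%N] =
          A `&` [set w | (k <= B n.+1 w)%N].
  have e w : A w -> (j.+1 < lam_index n w)%N = (k <= B n.+1 w)%N.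
    move=> Aw; rewrite lam_indexE// ltn_good_index//; last exact: opp_R_ge0.
    by rewrite le_opp_R// cellB// cellY// kE ler_nat.
  by apply/seteqP; split=> w [Aw /=]; rewrite e.
have Y0E : y [tuple B i.+1 w0 | i < n] = opp_Y B y n w0 by [].
rewrite past_tail// ?Y0E//.
- congr (_ * (F _)%:E)%E; rewrite /opp_delta -kE.
  have -> : lam j.+1 * phi n (B n w0) + (lam j.+1 - 1) * opp_Y B y n w0 *
      phi n (B n w0) + phi n (B n w0) * opp_Y B y n w0 =
      lam j.+1 * (phi n (B n w0) * (1 + opp_Y B y n w0)) by ring.
  rewrite invfM mulrCA divff ?mulr1// mulf_neq0 ?gt_eqF//.
  by rewrite ltr_wpDr.
- exact: (opp_B_gt0 opp).
- move=> i /andP[i2 iN].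
  have i1 : (1 <= i.-1)%N by case: (i) i2 => [|[]].
  have := phi_le i.-1 i1; rewrite prednK; last exact: ltnW.
  by rewrite !Aw1// ?(ltnW i2)//= i1 (leq_trans (leq_pred _)).
- rewrite -kE -subr_ge0.
  have -> : lam j.+1 * phi n (B n w0) + (lam j.+1 - 1) * opp_Y B y n w0 *
      phi n (B n w0) - phi n (B n w0) =
      (lam j.+1 - 1) * (phi n (B n w0) * (1 + opp_Y B y n w0)) by ring.
  by rewrite mulr_ge0 ?subr_ge0// mulr_ge0 ?addr_ge0// ltW.
Unshelve. all: by end_near. Qed.

Lemma iid_lam_index : iid_past P past_code lam_index index_tail.
Proof.
split; [exact: measurable_past_code|exact: lam_index_eq|exact: lam_index_gt0|].
by move=> n v j; exact: lam_index_tail.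
Qed.

End past.

Section distribution_tail.
Variables (R : realType) (F : cumulativeBounded (0 : R) (1 : R)) (lam : nat -> R).
Hypothesis F0 : F 0 = 0.
Hypothesis F1 : F 1 = 1.
Hypothesis good : good_sequence lam.

Let F_le x y : x <= y -> F x <= F y.
Proof. exact: cumulative_is_nondecreasing. Qed.

Lemma cdf_le1 x : x <= 1 -> F x <= 1.
Proof. by move/F_le; rewrite F1. Qed.

Lemma tail_ge0 j : 0 <= index_tail F lam j.
Proof.
case: j => //= j.
have : F 0 <= F (lam j.+1)^-1 by rewrite F_le// invr_ge0 good_ge0.
by rewrite F0.
Qed.

Lemma tailS_le j : index_tail F lam j.+1 <= index_tail F lam j.
Proof.
have lam0 i : 0 < lam i.+1 by exact: lam_gt0.
case: j => [|j] /=; first by rewrite cdf_le1// invf_le1// good_ge1.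
by apply: F_le; rewrite lef_pV2 ?posrE// good_le.
Qed.

Lemma lam_tailE j : (1 <= j)%N ->
  lam j * index_tail F lam j = F (lam j)^-1 / (lam j)^-1.
Proof. by case: j => // j _; rewrite invrK mulrC. Qed.

Lemma inv_lam_itv j : (1 <= j)%N -> 0 < (lam j)^-1 <= 1.
Proof. by move=> j1; rewrite invr_gt0 lam_gt0//= invf_le1 ?lam_gt0// good_ge1. Qed.

Lemma lam_tail_le C : (forall x, 0 < x <= 1 -> F x <= C * x) ->
  forall j, lam j * index_tail F lam j <= C.
Proof.
move=> FC [|j].
  rewrite (good_0 good) mul0r; have := FC 1.
  by rewrite F1 mulr1 ltr01 lexx => /(_ isT); lra.
have /andP[i0 i1] := @inv_lam_itv j.+1 isT.
by rewrite lam_tailE// ler_pdivrMr// FC// i0.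
Qed.

Lemma cvg_lam_tail (alpha : R) : F x / x @[x --> 0^'+] --> alpha ->
  lam j * index_tail F lam j @[j --> \oo] --> alpha.
Proof.
move=> Falpha; rewrite -cvg_shiftS/=.
have := (cvg_at_rightP (fun x => F x / x) 0 alpha).1 Falpha.
move=> /(_ (fun j => (lam j.+1)^-1)).
have -> : (fun j => lam j.+1 * F (lam j.+1)^-1) =
          (fun j => F (lam j.+1)^-1 / (lam j.+1)^-1).
  by apply/funext => j; rewrite invrK mulrC.
apply; split=> [j|]; first by rewrite invr_gt0 lam_gt0.
apply: (gtr0_cvgV0 (f := fun j => lam j.+1) _).2.
  by apply: nearW => j; exact: lam_gt0.
by rewrite (cvg_shiftS lam); exact: good_cvg.
Qed.

(** Near 0 by convergence of the ratio, elsewhere because F <= 1. *)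
Lemma cvg_ratio_bounded (alpha : R) : F x / x @[x --> 0^'+] --> alpha ->
  exists C : R, forall x, 0 < x <= 1 -> F x <= C * x.
Proof.
move=> /cvgrPdist_le/(_ 1 ltr01)[e /= e0 He].
exists (`|alpha + 1| + e^-1) => x /andP[x0 x1].
have [xe|ex] := ltP x e.
  have := He x; rewrite /ball_/= sub0r normrN gtr0_norm// => /(_ xe x0).
  rewrite ler_norml => /andP[h _].
  have {}h : F x / x <= alpha + 1 by lra.
  rewrite -ler_pdivrMr//; apply: le_trans h _.
  by apply: le_trans (ler_norm _) _; rewrite lerDl invr_ge0 ltW.
apply: (@le_trans _ _ 1); first exact: cdf_le1.
rewrite mulrDl -[X in X <= _]add0r lerD// ?mulr_ge0// ?(ltW x0)//.
by rewrite mulrC ler_pdivlMr// mul1r.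
Qed.

End distribution_tail.

(** * Trimmed sums of Oppenheim expansions *)

Theorem theorem4p4 (R : realType)
    (B : nat -> {RV (unit_lebesgue R) >-> nat})
    (phi : nat -> nat -> R) (y : forall n : nat, n.-tuple nat -> R)
    (F : cumulativeBounded (0 : R) (1 : R)) (lam : nat -> R) :
  oppenheim_expansion B phi y F ->
  good_sequence lam ->
  (forall j n, (1 <= n)%N -> {ae unit_lebesgue R, forall w,
     lam j * phi n (B n w) + (lam j - 1) * opp_Y B y n w * phi n (B n w)
       \is a Num.int}) ->
  let X n w := lam (good_index lam (opp_R B phi y n w)) in
  let Sr gamma beta n w :=
    trimmed_sum (opp_R B phi y) (trim_rank beta gamma n) n w in
  let d gamma n := truncated_mean (unit_lebesgue R) X gamma n in
  exists C : R, 0 < C /\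
    ((exists C1 C2 : R, 0 < C1 /\ C1 < C2 /\
        forall x, 0 < x <= 1 -> C1 <= F x / x <= C2) ->
      forall gamma beta : R, 0 < gamma < 2^-1 -> C < beta ->
      {ae unit_lebesgue R, forall w,
        Sr gamma beta n w / d gamma n @[n --> \oo] --> (1 : R)})
    /\
    (forall alpha : R, 0 < alpha -> F x / x @[x --> 0^'+] --> alpha ->
      forall gamma beta : R, 0 < gamma < 2^-1 -> C < beta ->
      {ae unit_lebesgue R, forall w,
        Sr gamma beta n w / (n%:R * ln n%:R) @[n --> \oo]
          --> alpha * gamma}).
Proof.
move=> opp good int_lam X Sr d.
have [F0 F1] := (opp_F0 opp, opp_F1 opp).
have [l0 l0_ub] := good_gap good.
have gap n : lam n.+1 - lam n <= l0 by apply: l0_ub; exists n.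
have XE k w : (1 <= k)%N -> X k w = lam (lam_index B phi y lam k w).
  by move=> k1; rewrite lam_indexE.
have Rge0 k w : (1 <= k)%N -> 0 <= opp_R B phi y k w.
  by move=> k1; exact: (opp_R_ge0 opp).
have RX k w : (1 <= k)%N ->
    opp_R B phi y k w <= lam (lam_index B phi y lam k w) <= opp_R B phi y k w + l0.
  move=> k1; rewrite lam_indexE//.
  have [g1 /andP[h1 h2]] := good_indexP good (Rge0 k w k1).
  rewrite (ltW h2)/=; have := gap (good_index lam (opp_R B phi y k w)).-1.
  by rewrite prednK//; lra.
pose t := index_tail F lam.
have t0 : t 0%N = 1 by [].
have t_ge0 : forall j, 0 <= t j by exact: tail_ge0.
have t_noninc : forall j, t j.+1 <= t j by exact: tailS_le.
have dE gamma n : d gamma n = n%:R * moment1 lam t (level lam (n%:R `^ gamma)).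
  exact: (truncated_meanE (iid_lam_index opp good int_lam) good gamma n XE).
pose bound C := (expR 1 - 1) * ((1 + l0) * C + l0) + 1.
have law_of_large_numbers C : (forall x, 0 < x <= 1 -> F x <= C * x) ->
    moment1 lam t m @[m --> \oo] --> +oo ->
    forall gamma beta, 0 < gamma < 2^-1 -> bound C < beta ->
    {ae unit_lebesgue R, forall w,
      Sr gamma beta n w / d gamma n @[n --> \oo] --> (1 : R)}.
  move=> FC mom gamma beta /andP[g0 g2] bb.
  have := ae_trimmed_sum (iid_lam_index opp good int_lam) good gap t0 t_ge0
    t_noninc (lam_tail_le F1 good FC) mom g0 g2 bb Rge0 RX.
  apply: filterS => w; apply: cvg_trans; apply: near_eq_cvg.
  by apply: nearW => n; rewrite dE.
(* The constant of the theorem comes from any linear bound on F, when there is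
   one; both assumptions on F provide one, but it has to be chosen before
   they are made. *)
have linear_tail_bound : exists C : R, 0 < C /\
    forall C2, (forall x, 0 < x <= 1 -> F x <= C2 * x) ->
    exists2 C3, (forall x, 0 < x <= 1 -> F x <= C3 * x) & bound C3 <= C.
  have [[C2 FC2]|noC2] :=
      pselect (exists C2, forall x, 0 < x <= 1 -> F x <= C2 * x); last first.
    by exists 1; split=> // C2 FC2; case: noC2; exists C2.
  exists (bound C2); split; last by move=> _ _; exists C2.
  have C2_ge1 : 1 <= C2.
    by have := FC2 1; rewrite F1 mulr1 ltr01 lexx; apply.
  have l1 := gap_ge1 good gap.
  have e1 : 0 <= expR 1 - 1 :> R by rewrite subr_ge0 -expR0 ler_expR.
  have c0 : 0 <= (1 + l0) * C2 + l0 by nra.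
  by have := mulr_ge0 e1 c0; rewrite /bound; lra.
have [C [C0 HC]] := linear_tail_bound.
exists C; split=> //; split.
  move=> [C1 [C2 [C1_gt0 [_ FC]]]] gamma beta gamma_itv Cbeta.
  have FC2 x : 0 < x <= 1 -> F x <= C2 * x.
    by move=> x01; have /andP[_] := FC x x01; rewrite ler_pdivrMr//; case/andP: x01.
  have [C3 FC3 bC3] := HC C2 FC2.
  apply: (law_of_large_numbers C3) => //; last exact: le_lt_trans bC3 Cbeta.
  apply: (moment1_pinfty good gap t0 (lam_tail_le F1 good FC3) C1_gt0) => j j1.
  by rewrite lam_tailE//; have /andP[] := FC _ (inv_lam_itv good j1).
move=> alpha a0 Falpha gamma beta gamma_itv Cbeta.
have [C2 FC2] := cvg_ratio_bounded F1 Falpha.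
have [C3 FC3 bC3] := HC C2 FC2.
have mom_ln : moment1 lam t m / ln (lam m) @[m --> \oo] --> alpha.
  apply: (moment1_ln good gap t0 t_ge0 (lam_tail_le F1 good FC3) (ltW a0)).
  exact: cvg_lam_tail.
have mom := moment1_pinfty_ln good a0 mom_ln.
have [g0 _] := andP gamma_itv.
have bbeta := le_lt_trans bC3 Cbeta.
apply: filterS (law_of_large_numbers C3 FC3 mom _ _ gamma_itv bbeta) => w Sd.
have lvl := cvg_level good g0.
have mom_lvl : moment1 lam t (level lam (n%:R `^ gamma)) /
    ln (lam (level lam (n%:R `^ gamma))) @[n --> \oo] --> alpha.
  exact: (cvg_comp _ _ lvl mom_ln).
have lim : Sr gamma beta n w / d gamma n *
    (moment1 lam t (level lam (n%:R `^ gamma)) /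
      ln (lam (level lam (n%:R `^ gamma)))) *
    (ln (lam (level lam (n%:R `^ gamma))) / ln n%:R)
    @[n --> \oo] --> alpha * gamma.
  rewrite -[alpha]mul1r; apply: cvgM; last exact: cvg_ln_level gap g0.
  exact: cvgM.
apply: cvg_trans lim; apply: near_eq_cvg.
have /cvgryPgt/(_ 0) mom_gt0 := cvg_comp _ _ lvl mom.
have /cvgryPgt/(_ 0) lnlam_gt0 := cvg_comp _ _ lvl (cvg_ln_lam good).
apply: filterS (filterI (nbhs_infty_ge 2%N) (filterI mom_gt0 lnlam_gt0)) => n.
move=> [/= n2 [mu0 lnm0]].
have n0 : n%:R != 0 :> R by rewrite pnatr_eq0 -lt0n ltnW.
have lnn0 : ln n%:R != 0 :> R by rewrite gt_eqF// ln_gt0// ltr1n.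
rewrite dE; move: mu0 lnm0; move: (moment1 _ _ _) (ln (lam _)) => mu lnl mu0 lnl0.
by field; rewrite n0 lnn0 !gt_eqF.
Qed.
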